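(* For every $w\in S_\infty$, $$\sum_{\alpha\in\mathcal C}\overleftarrow{\kappa^w_\alpha}\cdot\binom{|\alpha|}{\alpha}=|R(w)|.$$
   Context: Indices. $\mathcal C$ is the set of finitely supported tuples $\alpha=(\alpha_i)_{i\in\mathbb Z}$ of nonnegative integers; $|\alpha|=\sum_i\alpha_i$ and $\binom{|\alpha|}{\alpha}=|\alpha|!/\prod_{i\in\mathbb Z}\alpha_i!$. Permutations. $S_{\mathbb Z}$ is the group of permutations of $\mathbb Z$ moving only finitely many integers; $S_\infty\subset S_{\mathbb Z}$ is the subgroup of those fixing every $i\le 0$; $s_i=(i,i+1)$; $\ell$ is Coxeter length. The shift acts by $\gamma(w)(i)=w(i-1)+1$ and $\gamma(x_i)=x_{i+1}$. $R(w)$ is the set of reduced words of $w$: sequences $(a_1,\ldots,a_{\ell(w)})$ with $w=s_{a_1}\cdots s_{a_{\ell(w)}}$. Back stable coefficients. $\Lambda^-=\Lambda(\ldots,x_{-1},x_0)$ is the ring of symmetric functions over $\mathbb Q$ in the variables $x_i$, $i\le0$, and $\mathcal R=\Lambda^-\otimes_{\mathbb Q}\mathbb Q[x_i\mid i\in\mathbb Z]$, identified via multiplication with a ring of bounded-degree formal power series. The elements $\overleftarrow{\mathbf e}_\alpha=\prod_{i\in\mathbb Z}\mathbf e_{\alpha_i}(\ldots,x_{i-1},x_i)$ ($\alpha\in\mathcal C$), where $\mathbf e_d(\ldots,x_{k-1},x_k)$ is the elementary symmetric function in $x_i$, $i\le k$, form a $\mathbb Q$-basis of $\mathcal R$. For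 $u\in S_\infty$, $\mathfrak S_u$ is the usual Schubert polynomial: $\mathfrak S_{w_0}=x_1^{n-1}\cdots x_{n-1}$ for the longest $w_0\in S_n$, and $\partial_i\mathfrak S_u=\mathfrak S_{us_i}$ whenever $\ell(us_i)<\ell(u)$, where $\partial_i f=(f-s_if)/(x_i-x_{i+1})$. For $w\in S_{\mathbb Z}$, $\overleftarrow{\mathfrak S}_w=\lim_{m\to\infty}\gamma^{-m}\big(\mathfrak S_{\gamma^m(w)}\big)\in\mathcal R$ (coefficientwise limit, over $m$ with $\gamma^m(w)\in S_\infty$), and $\overleftarrow{\kappa^w_\alpha}$ is defined by $\overleftarrow{\mathfrak S}_w=\sum_{\alpha\in\mathcal C}\overleftarrow{\kappa^w_\alpha}\,\overleftarrow{\mathbf e}_\alpha$. *)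

(* Defs.v *)
From HB Require Import structures.
From mathcomp Require Import all_boot all_order all_algebra finmap.
From mathcomp Require Import boolp classical_sets functions cardinality fsbigop.
From mathcomp Require Import monalg.

Set Implicit Arguments.
Unset Strict Implicit.
Unset Printing Implicit Defensive.

Import Order.TTheory GRing.Theory Num.Theory.

Local Open Scope classical_set_scope.
Local Open Scope ring_scope.

(* Elements of S_Z are represented by their underlying functions int -> int,
   so the group law is \o and (with functional extensionality) equality of
   permutations is equality of functions. *)
Definition S_Z : set (int -> int) :=
  [set w | bijective w /\ finite_set [set i | w i <> i]].

Definition S_infty : set (int -> int) :=
  [set w | S_Z w /\ forall i : int, i <= 0 -> w i = i].

Definition S_fin (n : nat) : set (int -> int) :=
  [set w | S_infty w /\ forall i : int, n%:Z < i -> w i = i].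

Definition simple_refl (i : int) : int -> int :=
  fun j => if j == i then i + 1 else if j == i + 1 then i else j.

Definition word_prod (a : seq int) : int -> int :=
  foldr (fun i v => simple_refl i \o v) id a.

Definition coxeter_length (w : int -> int) : nat :=
  xget 0%N [set n : nat |
    (exists2 a, size a = n & w = word_prod a) /\
    (forall a, w = word_prod a -> (n <= size a)%N)].

Definition reduced_words (w : int -> int) : set (seq int) :=
  [set a | size a = coxeter_length w /\ w = word_prod a].

Definition is_longest (n : nat) (w0 : int -> int) : Prop :=
  S_fin n w0 /\
  forall v, S_fin n v -> (coxeter_length v <= coxeter_length w0)%N.

Definition shift_perm (w : int -> int) : int -> int := fun i => w (i - 1) + 1.

(* Both the monomials in the x_i (i : int) and the finitely supported tuples
   indexing the e-basis are elements of {cmonom int}; [mdeg a] is |a|. *)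
Notation mono := {cmonom int}.
Notation poly_Z := {malg rat[{cmonom int}]}.

Definition multinomial (a : mono) : rat :=
  ((mdeg a)`!)%:R / (\prod_(i <- finsupp a) (a i)`!)%N%:R.

Definition var (i : int) : poly_Z := << ucm i >>.

(* The substitution x_i |-> x_(s i), as a ring endomorphism. *)
Definition rename (s : int -> int) (f : poly_Z) : poly_Z :=
  mmap (fun c : rat => c%:MP)
       (fun m : mono => \prod_(i <- finsupp m) var (s i) ^+ m i) f.

(* The quotient by x_i - x_(i+1) is exact and unique. *)
Definition divdiff (i : int) (f : poly_Z) : poly_Z :=
  xget 0 [set g | (var i - var (i + 1)) * g = f - rename (simple_refl i) f].

Definition is_schubert (Sch : (int -> int) -> poly_Z) : Prop :=
  (forall (n : nat) w0, is_longest n w0 ->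
     Sch w0 = \prod_(1 <= i < n) var i%:Z ^+ (n - i)) /\
  (forall u i, S_infty u ->
     (coxeter_length (u \o simple_refl i) < coxeter_length u)%N ->
     divdiff i (Sch u) = Sch (u \o simple_refl i)).

(* The defining properties determine the values on S_infty; the values
   elsewhere are unspecified. *)
Definition schubert : (int -> int) -> poly_Z := xget (fun=> 0) is_schubert.

(* A formal power series is given by its coefficients.  Its product is
   [series_mul], not the pointwise product that function types inherit. *)
Notation series := ({cmonom int} -> rat).

Definition series_one : series := fun m => (m == mone)%:R.

Definition series_mul (f g : series) : series := fun m =>
  \sum_(p \in [set p : mono * mono | mmul p.1 p.2 = m]) f p.1 * g p.2.

(* e_d(..., x_(k-1), x_k) is the sum of the squarefree monomials of degree d
   in the x_i with i <= k. *)
Definition back_elem (d : nat) (k : int) : series := fun m =>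
  ((mdeg m == d) && all (fun i => (m i == 1%N) && (i <= k)) (finsupp m))%:R.

Definition back_e (a : mono) : series :=
  \big[series_mul/series_one]_(i <- finsupp a) back_elem (a i) i.

(* Coefficientwise limit: every coefficient is eventually constant. *)
Definition back_schubert (w : int -> int) : series :=
  xget (fun=> 0) [set F : series | forall mu : mono, exists N : nat,
    forall m : nat, (N <= m)%N -> S_infty (iter m shift_perm w) ->
      (rename (fun i => i - m%:Z) (schubert (iter m shift_perm w)))@_mu
        = F mu].

Definition kappa (w : int -> int) : {fsfun mono -> rat with 0} :=
  xget [fsfun] [set k : {fsfun mono -> rat with 0} | forall mu : mono,
    back_schubert w mu = \sum_(a <- finsupp k) k a * back_e a mu].

(* Main.v *)
Require Import Defs.
From mathcomp Require Import all_boot all_order all_algebra finmap.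
From mathcomp Require Import boolp classical_sets functions cardinality fsbigop.
From mathcomp Require Import monalg.
From HB Require Import structures.
From mathcomp Require Import zify lra.

(** The coefficient of a squarefree monomial of degree d, in variables whose
    indices are below every index of alpha, in the product of the
    e_(alpha_i)(..., x_(i-1), x_i) is the multinomial coefficient of alpha if
    d = |alpha|, and 0 otherwise. Hence the left-hand side is the sum over d of
    these coefficients of the back stable Schubert series F_w, which is
    homogeneous of degree l(w). Writing such a monomial as x_a nu and
    telescoping the coefficients of x_i nu over i >= a, consecutive differences
    are the coefficients of nu in the divided differences F_(w s_i), i running
    over the descents of w: this is the recursion satisfied by |R(w)|.

    The expansion of F_w exists because F_w is bounded, homogeneous, and
    symmetric in the variables x_i with i <= 0. *)

Set Implicit Arguments.
Unset Strict Implicit.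
Unset Printing Implicit Defensive.

Import Order.TTheory GRing.Theory Num.Theory.

Local Open Scope classical_set_scope.
Local Open Scope ring_scope.

(** * Permutations of the integers *)

(** [schubert], [back_schubert] and [kappa] are picked by [xget] from a defining property, so the
    existence of each has to be established before anything can be read off. For Schubert
    polynomials this means that all chains of divided differences out of the longest element give
    the same value: within one S_n by the commutation and braid relations, and from S_n to S_(n+1)
    by an explicit chain between the two staircase monomials. Series are bare coefficient functions,
    so divided differences enter only through the identity (x_j - x_(j+1)) G = F - s_j F read on
    coefficients, which passes to the limit. It yields symmetry when G = 0, and symmetry together
    with a bound on the variables yields vanishing: this device gives both the variables of a
    Schubert polynomial and its stability under the shift. The evaluation at squarefree monomials
    applies to every finite expansion of F_w, in particular to the chosen one. Existence of an
    expansion rests on a leading term argument on the number of variables in a monomial, and on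
    straightening products of elementary functions in different alphabets. *)

Lemma simple_refl_spec i j :
  (j = i /\ simple_refl i j = i + 1) \/ (j = i + 1 /\ simple_refl i j = i) \/
  (j <> i /\ j <> i + 1 /\ simple_refl i j = j).
Proof.
rewrite /simple_refl; case: eqP => [->|ji]; first by left.
by case: eqP => [->|ji']; [right; left|right; right].
Qed.

Ltac simple_refl_lia :=
  repeat match goal with |- context [simple_refl ?i ?j] =>
    let r := fresh "r" in
    have := simple_refl_spec i j; set r := simple_refl i j; move: r => r
  end; lia.

Lemma simple_reflK i : involutive (simple_refl i).
Proof. by move=> j; simple_refl_lia. Qed.

Lemma simple_reflL i : simple_refl i i = i + 1.
Proof. by rewrite /simple_refl eqxx. Qed.

Lemma simple_reflR i : simple_refl i (i + 1) = i.
Proof. by simple_refl_lia. Qed.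

Lemma comp_simple_reflK i (w : int -> int) :
  (w \o simple_refl i) \o simple_refl i = w.
Proof. by apply/funext => j /=; rewrite simple_reflK. Qed.

Lemma simple_refl_comm i j : i + 1 < j ->
  simple_refl i \o simple_refl j = simple_refl j \o simple_refl i.
Proof. by move=> ij; apply/funext => k /=; simple_refl_lia. Qed.

Lemma simple_refl_braid i :
  simple_refl i \o simple_refl (i + 1) \o simple_refl i =
  simple_refl (i + 1) \o simple_refl i \o simple_refl (i + 1).
Proof. by apply/funext => k /=; simple_refl_lia. Qed.

Lemma S_Z_bound w : S_Z w ->
  exists N : nat, forall i : int, (i < - N%:Z) || (N%:Z < i) -> w i = i.
Proof.
move=> [_ /finite_fsetP[X XE]]; exists (\sum_(i <- X) `|i|)%N => i iN.
apply: contrapT => wi; have : i \in X by have : [set` X] i by rewrite -XE.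
by move=> iX; move: iN; rewrite (big_fsetD1 i iX) /=; lia.
Qed.

Lemma S_Z_comp w i : S_Z w -> S_Z (w \o simple_refl i).
Proof.
move=> [wb wf]; split.
  by apply: bij_comp => //; exists (simple_refl i); apply: simple_reflK.
apply: (@sub_finite_set _ _ ([set j | w j <> j] `|` ([set i] `|` [set i + 1]))).
  move=> j /= wj; case: (pselect (j = i)) => [->|ji]; first by right; left.
  case: (pselect (j = i + 1)) => [->|ji']; first by right; right.
  by left; move: wj; rewrite /simple_refl; case: eqP => // _; case: eqP.
by rewrite !finite_setU; split => //; split; exact: finite_set1.
Qed.

Lemma S_Z_inj w : S_Z w -> injective w.
Proof. by move=> [/bij_inj]. Qed.

Lemma S_Z_id : S_Z id.
Proof.
split; first by exists id.
by rewrite (_ : mkset _ = set0) //; apply/seteqP; split => // i /=.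
Qed.

(** * Inversions and Coxeter length *)

Definition inversions (w : int -> int) : set (int * int) :=
  [set p | p.1 < p.2 /\ w p.2 < w p.1].

Definition inv_number (w : int -> int) : nat :=
  #|` fset_set (inversions w)|.

(** Outside [-N, N] the permutation is the identity, so it maps this window to itself; both entries
    of an inversion must then lie in the window. *)
Lemma inversions_fin w : S_Z w -> finite_set (inversions w).
Proof.
move=> wS; have [N wN] := S_Z_bound wS; have wI := S_Z_inj wS.
pose s : seq int := [seq k%:Z - N%:Z | k <- iota 0 (2 * N).+1].
pose t := [seq (a, b) | a <- s, b <- s].
apply: (@sub_finite_set _ _ [set` t]); last first.
  exact: finite_seq.
have sP (i : int) : - N%:Z <= i -> i <= N%:Z -> i \in s.
  move=> h1 h2; apply/mapP; exists (absz (i + N%:Z)%R); last by lia.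
  by rewrite mem_iota; lia.
move=> [a b] /= [/= ab wab].
have fixP (i j : int) : (w j < - N%:Z) || (N%:Z < w j) -> w i = w j -> w (w j) = w j.
  by move=> h _; apply: wN.
have wv (j : int) : (w j < - N%:Z) || (N%:Z < w j) -> w j = j by move=> /wN/wI.
suff: (a, b) \in t by []; apply/allpairsP; exists (a, b); split => //=; apply: sP.
- rewrite leNgt; apply/negP => aN; have wa : w a = a by apply: wN; rewrite aN.
  have := wv b; rewrite wa in wab; lia.
- rewrite leNgt; apply/negP => aN; have wa : w a = a by apply: wN; rewrite aN orbT.
  have wb : w b = b by apply: wN; lia.
  lia.
- rewrite leNgt; apply/negP => aN; have wa : w b = b by apply: wN; rewrite aN.
  have wb : w a = a by apply: wN; lia.
  lia.
- rewrite leNgt; apply/negP => aN; have wa : w b = b by apply: wN; rewrite aN orbT.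
  have := wv a; rewrite wa in wab; lia.
Qed.

(** The transposition s_i, acting on pairs of positions, keeps the order in every increasing pair
    except (i, i + 1); this pair is the one new inversion. *)
Lemma inv_number_asc w i : S_Z w -> w i < w (i + 1) ->
  inv_number (w \o simple_refl i) = (inv_number w).+1.
Proof.
move=> wS wi; pose f (p : int * int) := (simple_refl i p.1, simple_refl i p.2).
have fK : involutive f by move=> [a b]; rewrite /f /= !simple_reflK.
have E : fset_set (inversions (w \o simple_refl i)) =
    ((i, (i + 1)%R) |` (f @` fset_set (inversions w)))%fset.
  apply/fsetP => -[a b]; rewrite in_fset_set; last exact/inversions_fin/S_Z_comp.
  rewrite !inE; apply/idP/orP.
    rewrite inE /= => -[/= ab wab].
    have [/andP[/eqP-> /eqP->]|nab] := boolP ((a == i) && (b == i + 1)); first by left.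
    right; apply/imfsetP; exists (f (a, b)); last by rewrite fK.
    rewrite in_fset_set; last exact: inversions_fin.
    by rewrite inE; split => //=; move: ab nab; simple_refl_lia.
  move=> [/eqP[-> ->]|/imfsetP[[c d]] /=].
    by rewrite inE; split => /=; rewrite ?simple_reflL ?simple_reflR; lia.
  rewrite in_fset_set; last exact: inversions_fin.
  rewrite inE => -[/= cd wcd] [-> ->]; rewrite inE; split => /=; rewrite ?simple_reflK //.
  have : ~~ ((c == i) && (d == i + 1)).
    by apply/negP => /andP[/eqP ci /eqP di]; move: wcd; rewrite ci di; lia.
  by move: cd; simple_refl_lia.
rewrite /inv_number E cardfsU1 card_imfset /=; last exact: inv_inj.
rewrite (_ : _ \notin _) //; apply/negP => /imfsetP[[c d]] /=.
rewrite in_fset_set; last exact: inversions_fin.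
by rewrite inE => -[/= cd wcd] [h1 h2]; move: cd h1 h2; simple_refl_lia.
Qed.

Lemma inv_number_desc w i : S_Z w -> w (i + 1) < w i ->
  inv_number w = (inv_number (w \o simple_refl i)).+1.
Proof.
move=> wS wi; rewrite -{1}(comp_simple_reflK i w) inv_number_asc //.
  exact: S_Z_comp.
by rewrite /= simple_reflL simple_reflR.
Qed.

Lemma S_Z_asc_or_desc w i : S_Z w -> ~ (w (i + 1) < w i) -> w i < w (i + 1).
Proof.
move=> wS wi; have : w i <> w (i + 1) by move=> /(S_Z_inj wS); lia.
lia.
Qed.

(** Without descents w is increasing; starting from the fixed points far to the left this gives j <=
    w(j), and from those far to the right w(j) <= j. *)
Lemma S_Z_descent w : S_Z w -> w <> id -> exists i, w (i + 1) < w i.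
Proof.
move=> wS wid; apply: contrapT => nd; apply: wid; apply/funext => i.
have [N wN] := S_Z_bound wS.
have asc (j : int) : w j < w (j + 1).
  by apply: S_Z_asc_or_desc => // h; apply: nd; exists j.
have lo (n : nat) (j : int) : j < - N%:Z + n%:Z -> j <= w j.
  elim: n j => [|n IH] j jn; first by rewrite wN //; lia.
  have /IH : j - 1 < - N%:Z + n%:Z by lia.
  by have := asc (j - 1); rewrite subrK; lia.
have hi (n : nat) (j : int) : N%:Z - n%:Z < j -> w j <= j.
  elim: n j => [|n IH] j jn; first by rewrite wN //; lia.
  have /IH : N%:Z - n%:Z < j + 1 by lia.
  by have := asc j; lia.
have := lo (absz (i + N%:Z + 1)%R) i ltac:(lia).
by have := hi (absz (i - N%:Z - 1)%R) i ltac:(lia); lia.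
Qed.

Lemma inversions_id : inversions id = set0.
Proof. by apply/seteqP; split => // -[a b] /= [/=]; lia. Qed.

Lemma inv_number_id : inv_number id = 0%N.
Proof. by rewrite /inv_number inversions_id fset_set0 cardfs0. Qed.

Lemma word_prod_rcons a i : word_prod (rcons a i) = word_prod a \o simple_refl i.
Proof. by elim: a => [|j a /= ->]. Qed.

Lemma word_prod_S_Z a : S_Z (word_prod a).
Proof.
elim/last_ind: a => [|a i IH]; first exact: S_Z_id.
by rewrite word_prod_rcons; apply: S_Z_comp.
Qed.

Lemma inv_number_word a : (inv_number (word_prod a) <= size a)%N.
Proof.
elim/last_ind: a => [|a i IH]; first by rewrite inv_number_id.
rewrite word_prod_rcons size_rcons; have aS := word_prod_S_Z a.
case: (pselect (word_prod a (i + 1) < word_prod a i)) => [d|/(S_Z_asc_or_desc aS) h].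
  by have := inv_number_desc aS d; lia.
by rewrite inv_number_asc.
Qed.

Lemma S_Z_word w : S_Z w -> exists2 a, size a = inv_number w & w = word_prod a.
Proof.
move: {2}(inv_number w) (erefl (inv_number w)) => n.
elim: n w => [|n IH] w nw wS.
  exists [::] => //; apply: contrapT => /(S_Z_descent wS)[i /(inv_number_desc wS)].
  by rewrite nw.
have [wid|/(S_Z_descent wS)[i wi]] := pselect (w = id).
  by move: nw; rewrite wid inv_number_id.
have [] := IH (w \o simple_refl i); [|exact: S_Z_comp|].
  by have := inv_number_desc wS wi; rewrite nw => -[].
move=> a sa wa; exists (rcons a i); last by rewrite word_prod_rcons -wa comp_simple_reflK.
by rewrite size_rcons sa (inv_number_desc wS wi).
Qed.

(** Some word has [inv_number w] letters and none has fewer, since a letter creates at most one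
    inversion; this also provides the value that [xget] picks. *)
Lemma coxeter_lengthE w : S_Z w -> coxeter_length w = inv_number w.
Proof.
move=> wS; have [a sa wa] := S_Z_word wS.
have : exists n, [set n | (exists2 a, size a = n & w = word_prod a) /\
    (forall a, w = word_prod a -> (n <= size a)%N)] n.
  by exists (inv_number w); split; [exists a|move=> b ->; apply: inv_number_word].
move=> /(xgetPex 0%N) [[b sb wb] /(_ a wa)]; rewrite -/(coxeter_length w) sa => h.
apply/eqP; rewrite eqn_leq h /= /coxeter_length -sb {1}wb; exact: inv_number_word.
Qed.

Lemma coxeter_length_desc w i : S_Z w ->
  (coxeter_length (w \o simple_refl i) < coxeter_length w)%N = (w (i + 1) < w i).
Proof.
move=> wS; rewrite !coxeter_lengthE //; last exact: S_Z_comp.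
have [d|/negP d] := boolP (w (i + 1) < w i); first by have := inv_number_desc wS d; lia.
by have := inv_number_asc wS (S_Z_asc_or_desc wS d); lia.
Qed.

(** * Reduced words *)

Lemma reduced_words_id : reduced_words id = [set [::]].
Proof.
have l0 : coxeter_length id = 0%N by rewrite (coxeter_lengthE S_Z_id) inv_number_id.
apply/seteqP; split => a /=; first by rewrite /reduced_words /= l0 => -[/size0nil].
by move=> ->; split; rewrite ?l0.
Qed.

(** If i were an ascent of w, the prefix [a] would spell w s_i, which has one inversion more than w,
    hence more inversions than [a] has letters. *)
Lemma reduced_words_rcons w a i : S_Z w ->
  reduced_words w (rcons a i) <->
  w (i + 1) < w i /\ reduced_words (w \o simple_refl i) a.
Proof.
move=> wS; rewrite /reduced_words /= !coxeter_lengthE //; last exact: S_Z_comp.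
rewrite size_rcons word_prod_rcons; split.
  move=> [sa wa]; have aS := word_prod_S_Z a.
  have wa' : word_prod a = w \o simple_refl i by rewrite wa comp_simple_reflK.
  have := inv_number_word a; rewrite wa' => h.
  have [d|/(S_Z_asc_or_desc wS) d] := pselect (w (i + 1) < w i).
    by do 2! split=> //; have := inv_number_desc wS d; lia.
  by have := inv_number_asc wS d; lia.
move=> [d [sa wa]]; split; first by rewrite (inv_number_desc wS d) sa.
by rewrite -wa comp_simple_reflK.
Qed.

(** Induction on the length: the last letter is a descent, and the descents lie in a finite window
    around the support of w. *)
Lemma reduced_words_fin w : S_Z w -> finite_set (reduced_words w).
Proof.
move: {2}(inv_number w) (erefl (inv_number w)) => n.
elim: n w => [|n IH] w nw wS.
  apply: (@sub_finite_set _ _ [set [::]]); last exact: finite_set1.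
  by move=> a [sa _]; move: sa; rewrite coxeter_lengthE // nw => /size0nil.
have [N wN] := S_Z_bound wS.
pose s : seq int := [seq k%:Z - N%:Z - 1 | k <- iota 0 (2 * N).+2].
apply: (@sub_finite_set _ _
  (\bigcup_(i in [set i | i \in s /\ w (i + 1) < w i])
     ((rcons^~ i) @` reduced_words (w \o simple_refl i)))).
  move=> a; case/lastP: a => [[]|a i].
    by rewrite coxeter_lengthE // nw.
  move/(reduced_words_rcons _ _ wS) => [d h]; exists i; last by exists a.
  split => //; apply/mapP; exists (absz (i + N%:Z + 1)%R); last first.
    have [iN|] := ltP (i + 1) (- N%:Z); last by lia.
    by move: d; rewrite !wN; lia.
  rewrite mem_iota /=; have [iN|] := ltP i (N%:Z + 1); last by move=> iN; move: d; rewrite !wN; lia.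
  have [iN'|] := ltP (i + 1) (- N%:Z); last by lia.
  by move: d; rewrite !wN; lia.
apply: bigcup_finite.
  apply: (@sub_finite_set _ _ [set` s]); last exact: finite_seq.
  by move=> i /= [].
move=> i /= [_ d]; apply: finite_image; apply: IH; last exact: S_Z_comp.
by have := inv_number_desc wS d; rewrite nw => -[].
Qed.

Definition n_reduced_words (w : int -> int) : nat := #|` fset_set (reduced_words w)|.

Lemma n_reduced_words_id : n_reduced_words id = 1%N.
Proof. by rewrite /n_reduced_words reduced_words_id fset_set1 cardfs1. Qed.

(** Reduced words are sorted by their last letter. The list [s] may contain more than the descents,
    so that the sum can be matched with a telescoping sum over an interval. *)
Lemma n_reduced_words_rec w (s : seq int) : S_Z w -> w <> id -> uniq s ->
  (forall i, w (i + 1) < w i -> i \in s) ->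
  n_reduced_words w =
  (\sum_(i <- s) if (w (i + 1) < w i)%R then n_reduced_words (w \o simple_refl i) else 0)%N.
Proof.
move=> wS wid us ds.
have wiS i : S_Z (w \o simple_refl i) by apply: S_Z_comp.
pose A i := if w (i + 1) < w i then
  [fset rcons a i | a in fset_set (reduced_words (w \o simple_refl i))]%fset else fset0.
have -> : n_reduced_words w = #|` \bigcup_(i <- s) A i|%fset.
  congr (#|` _|); apply/fsetP => a; rewrite in_fset_set; last exact: reduced_words_fin.
  apply/idP/bigfcupP.
    rewrite inE; case/lastP: a => [[_ wa]|a i]; first by case: wid.
    move/(reduced_words_rcons _ _ wS) => [d h]; exists i; first by rewrite ds.
    rewrite /A d; apply/imfsetP; exists a => //=.
    by rewrite in_fset_set ?inE //; apply: reduced_words_fin.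
  move=> [i _]; rewrite /A; case: ifP => // d /imfsetP[b /=].
  rewrite in_fset_set; last exact: reduced_words_fin.
  by rewrite inE => h ->; rewrite inE; apply/(reduced_words_rcons _ _ wS).
have cA i : #|` A i| = if w (i + 1) < w i then n_reduced_words (w \o simple_refl i) else 0%N.
  rewrite /A; case: ifP => _; last by rewrite cardfs0.
  by rewrite card_imfset //= => a b /rcons_inj[].
have dA i j a : a \in A i -> a \in A j -> i = j.
  rewrite /A; case: ifP => // _; case: ifP => // _ /imfsetP[b _ ->] /imfsetP[c _].
  by move/rcons_inj => [].
elim: s us {ds} => [|i s IH] /=; first by rewrite !big_nil cardfs0.
move=> /andP[iN us]; rewrite !big_cons -IH // -cA cardfsU.
rewrite (_ : (_ `&` _)%fset = fset0) ?cardfs0 ?subn0 //.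
apply/fsetP => a; rewrite !inE; apply/negP => /andP[ai /bigfcupP[j /andP[js _] aj]].
by move: iN; rewrite (dA _ _ _ ai aj) js.
Qed.

Lemma descent_gt u (m i : int) : S_Z u -> (forall j : int, j <= m -> u j = j) ->
  u (i + 1) < u i -> m < i.
Proof.
move=> uS um d; rewrite ltNge; apply/negP => im; have ui := um i im.
have [/um h|h] := leP (i + 1) m; first by lia.
have /um/(S_Z_inj uS) : u (i + 1) <= m by lia.
lia.
Qed.

Lemma descent_lt u (n i : int) : S_Z u -> (forall j : int, n < j -> u j = j) ->
  u (i + 1) < u i -> i < n.
Proof.
move=> uS un d; rewrite ltNge; apply/negP => ni; have ui1 := un (i + 1) ltac:(lia).
have [/un h|h] := ltP n i; first by lia.
have /un/(S_Z_inj uS) : n < u i by lia.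
lia.
Qed.

Lemma S_infty_descent u i : S_infty u -> u (i + 1) < u i -> 0 < i.
Proof. by move=> [uS u0]; apply: descent_gt. Qed.

Lemma S_infty_comp u i : S_infty u -> 0 < i -> S_infty (u \o simple_refl i).
Proof.
move=> [uS u0] i0; split; first exact: S_Z_comp.
by move=> j j0 /=; rewrite (_ : simple_refl i j = j) ?u0 //; simple_refl_lia.
Qed.

Lemma S_fin_comp n u (i : int) : S_fin n u -> 0 < i -> i < n%:Z ->
  S_fin n (u \o simple_refl i).
Proof.
move=> [uS un] i0 ilt; split; first exact: S_infty_comp.
by move=> j j0 /=; rewrite (_ : simple_refl i j = j) ?un //; simple_refl_lia.
Qed.

Lemma S_fin_ge n n' u : (n <= n')%N -> S_fin n u -> S_fin n' u.
Proof. by move=> nn [uS un]; split => // j jn; apply: un; lia. Qed.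

Lemma S_infty_fin u : S_infty u -> exists n, S_fin n u.
Proof.
move=> uS; have [N uN] := S_Z_bound uS.1; exists N; split => // j jN.
by apply: uN; rewrite jN orbT.
Qed.

(** * The longest element of S_n *)

Definition rev_perm (n : nat) : int -> int :=
  fun i => if (0 < i) && (i <= n%:Z) then n%:Z + 1 - i else i.

Lemma rev_perm_in n (i : int) : 0 < i -> i <= n%:Z -> rev_perm n i = n%:Z + 1 - i.
Proof. by rewrite /rev_perm => -> ->. Qed.

Lemma rev_perm_out n (i : int) : (i <= 0) || (n%:Z < i) -> rev_perm n i = i.
Proof. by rewrite /rev_perm => h; case: ifP => //; lia. Qed.

Lemma rev_permK n : involutive (rev_perm n).
Proof.
move=> i; have [h|h] := boolP ((i <= 0) || (n%:Z < i)).
  by rewrite !(rev_perm_out h).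
by rewrite [rev_perm n i]rev_perm_in ?rev_perm_in; lia.
Qed.

Lemma S_fin_rev n : S_fin n (rev_perm n).
Proof.
split; last by move=> i ni; rewrite rev_perm_out ?ni ?orbT.
split; last by move=> i i0; rewrite rev_perm_out ?i0.
split; first by exists (rev_perm n); apply: rev_permK.
pose s : seq int := [seq k%:Z | k <- iota 0 n.+1].
apply: (@sub_finite_set _ _ [set` s]); last exact: finite_seq.
move=> i ri; apply/mapP; exists (absz i); last first.
  by have [h|] := boolP ((i <= 0) || (n%:Z < i)); [case: ri; rewrite rev_perm_out|lia].
rewrite mem_iota; have [h|] := boolP ((i <= 0) || (n%:Z < i)); last by lia.
by case: ri; rewrite rev_perm_out.
Qed.

Lemma S_fin_range n u (i : int) : S_fin n u -> 0 < i -> i <= n%:Z -> 0 < u i <= n%:Z.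
Proof.
move=> [[uS u0] un] i0 ilen; apply/andP; split.
  rewrite ltNge; apply/negP => h; have /(S_Z_inj uS) := u0 _ h; lia.
rewrite leNgt; apply/negP => h; have /(S_Z_inj uS) := un _ h; lia.
Qed.

(** A permutation decreasing on 1, ..., n is squeezed: counting from the left end gives u(i) <= n +
    1 - i, counting from the right end gives the reverse inequality. *)
Lemma S_fin_no_ascent n u : S_fin n u ->
  (forall i : int, 0 < i -> i < n%:Z -> ~ (u i < u (i + 1))) -> u = rev_perm n.
Proof.
move=> uS na; have [[uZ u0] un] := uS; have rg := S_fin_range uS.
have dec (i : int) : 0 < i -> i < n%:Z -> u (i + 1) < u i.
  move=> i0 ilt; apply: contrapT => h; apply: (na i i0 ilt).
  exact: S_Z_asc_or_desc.
have hi (k : nat) : (k < n)%N -> u (k%:Z + 1) <= n%:Z - k%:Z.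
  elim: k => [|k IH] kn; first by have := rg 1 ltac:(lia) ltac:(lia); rewrite add0r; lia.
  have := IH ltac:(lia); have := dec (k%:Z + 1) ltac:(lia) ltac:(lia).
  by rewrite (_ : k%:Z + 1 = k.+1%:Z); lia.
have lo (k : nat) : (k < n)%N -> k%:Z + 1 <= u (n%:Z - k%:Z).
  elim: k => [|k IH] kn; first by have := rg n%:Z ltac:(lia) ltac:(lia); rewrite subr0; lia.
  have := IH ltac:(lia); have := dec (n%:Z - k.+1%:Z) ltac:(lia) ltac:(lia).
  by rewrite (_ : n%:Z - k.+1%:Z + 1 = n%:Z - k%:Z); lia.
apply/funext => i; have [h|h] := boolP ((i <= 0) || (n%:Z < i)).
  by rewrite rev_perm_out //; case/orP: h => [/u0|/un].
rewrite rev_perm_in; [|lia|lia].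
have := hi (absz (i - 1)%R) ltac:(lia); have := lo (absz (n%:Z - i)%R) ltac:(lia).
rewrite (_ : n%:Z - (absz (n%:Z - i)%R)%:Z = i); last by lia.
by rewrite (_ : (absz (i - 1)%R)%:Z + 1 = i); lia.
Qed.

Lemma S_fin_ascent n u : S_fin n u -> u <> rev_perm n ->
  exists i : int, [/\ 0 < i, i < n%:Z & u i < u (i + 1)].
Proof.
move=> uS ur; apply: contrapT => h; apply: ur; apply: S_fin_no_ascent => // i i0 ilt a.
by apply: h; exists i.
Qed.

(** Only pairs inside 1, ..., n can be inverted by u, and [rev_perm] inverts all of them. *)
Lemma inv_number_rev_max n u : S_fin n u -> (inv_number u <= inv_number (rev_perm n))%N.
Proof.
move=> [[uS u0] un]; have [[rS _] _] := S_fin_rev n; apply: fsubset_leq_card.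
apply/fsubsetP => -[a b].
rewrite !in_fset_set; [|exact: inversions_fin|exact: inversions_fin].
rewrite !inE => -[/= ab uab]; split => //=.
have a0 : 0 < a.
  rewrite ltNge; apply/negP => h; have ua := u0 _ h.
  have /u0/(S_Z_inj uS) : u b <= 0 by lia.
  lia.
have bn : b <= n%:Z.
  rewrite leNgt; apply/negP => h; have ub := un _ h.
  have /un/(S_Z_inj uS) : n%:Z < u a by lia.
  lia.
by rewrite !rev_perm_in; lia.
Qed.

Lemma rev_perm_longest n : is_longest n (rev_perm n).
Proof.
have rS := S_fin_rev n; split => // v vS.
by rewrite !coxeter_lengthE ?inv_number_rev_max //; [exact: rS.1.1|exact: vS.1.1].
Qed.

Lemma longest_eq n w0 : is_longest n w0 -> w0 = rev_perm n.
Proof.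
move=> [wS wmax]; apply: S_fin_no_ascent => // i i0 ilt a.
have := wmax _ (S_fin_comp wS i0 ilt); have wZ := wS.1.1.
rewrite !coxeter_lengthE //; last exact: S_Z_comp.
by rewrite inv_number_asc //; lia.
Qed.

Lemma rev_perm_descent n (i : int) : 0 < i -> i < n%:Z ->
  rev_perm n (i + 1) < rev_perm n i.
Proof. by move=> i0 ilt; rewrite !rev_perm_in; lia. Qed.

(** * The shift *)

Lemma iter_shift_permE m w i : iter m shift_perm w i = w (i - m%:Z) + m%:Z.
Proof.
elim: m i => [|m IH] i /=; first by rewrite subr0 addr0.
rewrite /shift_perm IH (_ : i - 1 - m%:Z = i - m.+1%:Z); lia.
Qed.

Lemma shift_perm_comp w i :
  shift_perm (w \o simple_refl i) = shift_perm w \o simple_refl (i + 1).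
Proof.
apply/funext => j; rewrite /shift_perm /=.
by rewrite (_ : simple_refl i (j - 1) = simple_refl (i + 1) j - 1) //; simple_refl_lia.
Qed.

Lemma iter_shift_perm_comp m w i :
  iter m shift_perm (w \o simple_refl i) = iter m shift_perm w \o simple_refl (i + m%:Z).
Proof.
elim: m => [|m IH] /=; first by rewrite addr0.
by rewrite IH shift_perm_comp -addrA (_ : m%:Z + 1 = m.+1%:Z); last by lia.
Qed.

Lemma shift_perm_fin n w : S_fin n w -> S_fin n.+1 (shift_perm w).
Proof.
move=> [[[[g gK Kg] wf] w0] wn]; split; last by move=> i ni; rewrite /shift_perm wn; lia.
split; last by move=> i i0; rewrite /shift_perm w0; lia.
split.
  exists (shift_perm g) => i; rewrite /shift_perm addrK.
    by rewrite gK; lia.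
  by rewrite Kg; lia.
apply: (@sub_finite_set _ _ ((fun i => i + 1) @` [set i | w i <> i])); last exact: finite_image.
move=> i /= wi; exists (i - 1); last by lia.
by move=> h; apply: wi; rewrite /shift_perm h; lia.
Qed.

Lemma iter_shift_perm_fin m n w : S_fin n w -> S_fin (n + m) (iter m shift_perm w).
Proof.
move=> wS; elim: m => [|m IH]; first by rewrite addn0.
by rewrite addnS; apply: shift_perm_fin.
Qed.

Lemma iter_shift_perm_infty m w : S_infty w -> S_infty (iter m shift_perm w).
Proof. by move=> /S_infty_fin[n /(iter_shift_perm_fin m)[]]. Qed.

Lemma inv_number_shift w : S_infty w -> inv_number (shift_perm w) = inv_number w.
Proof.
move=> wS; have wZ := wS.1; have [n wn] := S_infty_fin wS.
have sZ := (shift_perm_fin wn).1.1.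
pose f (p : int * int) := (p.1 + 1, p.2 + 1).
rewrite /inv_number (_ : fset_set (inversions (shift_perm w)) =
  (f @` fset_set (inversions w))%fset).
  by rewrite card_imfset //= => -[a b] [c d] [/addIr-> /addIr->].
apply/fsetP => -[a b]; rewrite in_fset_set; last exact: inversions_fin.
apply/idP/imfsetP => /=.
  rewrite inE => -[/= ab wab]; exists (a - 1, b - 1); last by rewrite /f /= !subrK.
  rewrite in_fset_set; last exact: inversions_fin.
  by rewrite inE; split => /=; [lia|move: wab; rewrite /shift_perm; lia].
move=> [[c d]]; rewrite in_fset_set; last exact: inversions_fin.
rewrite inE => -[/= cd wcd] [-> ->]; rewrite inE; split => /=; first by lia.
by rewrite /shift_perm !addrK; lia.
Qed.

Lemma inv_number_iter_shift m w : S_infty w ->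
  inv_number (iter m shift_perm w) = inv_number w.
Proof.
move=> wS; elim: m => // m IH /=.
by rewrite inv_number_shift //; apply: iter_shift_perm_infty.
Qed.

(** * Divided differences *)

Implicit Types (m : mono) (i j : int).

(** For mutually inverse s and g this is the substitution of x_(g j) for x_j. The map g is carried
    along because it yields the finite support. *)
Definition mact (s g : int -> int) (m : mono) : mono :=
  [cmonom m (s i) | i in [fset g j | j in finsupp m]]%M.

Lemma mactE s g m i : cancel s g -> mact s g m i = m (s i).
Proof.
move=> sK; rewrite cmE fsfun_fun; case: ifP => // /negbT h.
apply/esym/eqP; rewrite cmE_eq0; apply: contra h => h.
by apply/imfsetP; exists (s i); rewrite ?sK.
Qed.

Lemma monoP (m m' : mono) : (forall i, m i = m' i) -> m = m'.
Proof. by move=> h; apply/eqP/cmP. Qed.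

Lemma mactM s g m m' : cancel s g -> mact s g (mmul m m') = mmul (mact s g m) (mact s g m').
Proof. by move=> sK; apply: monoP => i; rewrite !(mactE,cmM). Qed.

Lemma mactK s g m : cancel s g -> cancel g s -> mact s g (mact g s m) = m.
Proof. by move=> sK gK; apply: monoP => i; rewrite !mactE // sK. Qed.

Lemma mactU s g i : cancel s g -> cancel g s -> mact s g (ucm i) = ucm (g i).
Proof.
move=> sK gK; apply: monoP => j; rewrite mactE // !cmU; congr nat_of_bool.
by apply/eqP/eqP => [->|<-]; rewrite ?sK ?gK.
Qed.

Lemma finsupp_mact s g m : cancel s g -> cancel g s ->
  finsupp (mact s g m) = [fset g j | j in finsupp m]%fset.
Proof.
move=> sK gK; apply/fsetP => i; rewrite -cmE_neq0 mactE // cmE_neq0.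
apply/idP/imfsetP => [h|[j /= h ->]]; last by rewrite gK.
by exists (s i); rewrite ?sK.
Qed.

Lemma mdeg_mact s g m : cancel s g -> cancel g s -> mdeg (mact s g m) = mdeg m.
Proof.
move=> sK gK; rewrite /mdeg finsupp_mact // big_imfset /=; last first.
  by move=> i j _ _; apply: can_inj.
by apply: eq_bigr => i _; rewrite mactE // gK.
Qed.

Definition mswap (j : int) : mono -> mono := mact (simple_refl j) (simple_refl j).

Lemma mswapE j m i : mswap j m i = m (simple_refl j i).
Proof. by apply: mactE; apply: simple_reflK. Qed.

Lemma mswapK j : involutive (mswap j).
Proof. by move=> m; apply: mactK; apply: simple_reflK. Qed.

Definition mshift (k : int) : mono -> mono := mact (fun i => i - k) (fun i => i + k).

Lemma mshiftE k m i : mshift k m i = m (i - k).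
Proof. by apply: mactE => j; rewrite subrK. Qed.

Lemma mdeg_mshift k m : mdeg (mshift k m) = mdeg m.
Proof. by apply: mdeg_mact => i; rewrite ?subrK ?addrK. Qed.

Definition mdivx (m : mono) (i : int) : mono := divcm m (ucm i).

Lemma mdivxE m i j : mdivx m i j = (m j - (i == j))%N.
Proof. by rewrite /mdivx divcmE cmU. Qed.

Lemma mdivxK m i : (0 < m i)%N -> mmul (ucm i) (mdivx m i) = m.
Proof.
move=> mi; apply: monoP => j; rewrite cmM cmU mdivxE.
by case: eqP => [<-|_] /=; [rewrite add1n subn1 prednK|rewrite subn0].
Qed.

Lemma mulxK m i : mdivx (mmul (ucm i) m) i = m.
Proof. by apply: monoP => j; rewrite mdivxE cmM cmU addKn. Qed.

(** The monomial part of [rename], named so that it can carry the morphism structure that makes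
    [rename] a ring morphism. *)
Definition hmon (s : int -> int) (m : mono) : poly_Z :=
  \prod_(i <- finsupp m) var (s i) ^+ m i.

Lemma hmonw s m (d : {fset int}) : (finsupp m `<=` d)%fset ->
  hmon s m = \prod_(i <- d) var (s i) ^+ m i.
Proof.
move=> md; apply: big_fset_incl => // i _; rewrite memNfinsupp => /eqP ->.
by rewrite expr0.
Qed.

Lemma hmon_is_multiplicative s : mmorphism (hmon s).
Proof.
split; last by rewrite /hmon mdom1 big_seq_fset0.
move=> m m'; rewrite (@hmonw s m (finsupp m `|` finsupp m')%fset) ?fsubsetUl //.
rewrite (@hmonw s m' (finsupp m `|` finsupp m')%fset) ?fsubsetUr //.
rewrite /hmon mdomD -big_split /=; apply: eq_bigr => i _.
by rewrite cmM exprD.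
Qed.

HB.instance Definition _ s := isMultiplicative.Build {cmonom int} poly_Z (hmon s)
  (hmon_is_multiplicative s).

Lemma renameE s f : rename s f = mmap (@mkmalgU {cmonom int} rat mone) (hmon s) f.
Proof. by []. Qed.

Lemma renameB s (f g : poly_Z) : rename s (f - g) = rename s f - rename s g.
Proof. by rewrite !renameE raddfB. Qed.

Lemma renameD s (f g : poly_Z) : rename s (f + g) = rename s f + rename s g.
Proof. by rewrite !renameE raddfD. Qed.

Lemma rename0 s : rename s 0 = 0.
Proof. by rewrite !renameE raddf0. Qed.

Lemma renameM s (f g : poly_Z) : rename s (f * g) = rename s f * rename s g.
Proof. by rewrite !renameE rmorphM. Qed.

Lemma rename1 s : rename s 1 = 1.
Proof. by rewrite !renameE rmorph1. Qed.

Lemma renameC s c : rename s c%:MP = c%:MP.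
Proof. by rewrite renameE mmapC. Qed.

Lemma rename_var s i : rename s (var i) = var (s i).
Proof.
rewrite renameE mmapU /= mpolyC1E mul1r /hmon mdomU big_seq_fset1 cmUU expr1 //.
Qed.

Lemma rename_varB s i j : rename s (var i - var j) = var (s i) - var (s j).
Proof.
exact: etrans (renameB s (var i) (var j))
  (f_equal2 (fun x y => x - y) (rename_var s i) (rename_var s j)).
Qed.

Lemma malgUM (c d : rat) m m' :
  << c *g m >> * << d *g m' >> = << c * d *g mmul m m' >> :> poly_Z.
Proof. exact: fgmulUU. Qed.

Lemma malgU1M m m' : << m >> * << m' >> = << mmul m m' >> :> poly_Z.
Proof. by rewrite malgUM mulr1. Qed.

Lemma malgCU (c : rat) m : c%:MP * << m >> = << c *g m >> :> poly_Z.
Proof.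
have := malgUM c 1 mone m.
rewrite (mulr1 c).
by rewrite (mul1m m).
Qed.

Lemma varX_mono i n : exists2 m : mono, var i ^+ n = << m >> & forall j, m j = ((i == j) * n)%N.
Proof.
elim: n => [|n [m E mE]].
  by exists mone => [|j]; rewrite ?expr0 // cm1 muln0.
exists (mmul (ucm i) m) => [|j]; last by rewrite cmM cmU mE mulnS.
rewrite exprS E; exact: malgU1M.
Qed.

Lemma hmonE s g m : cancel s g -> cancel g s -> hmon g m = << mact s g m >>.
Proof.
move=> sK gK.
suff [m' E m'E] : exists2 m' : mono, hmon g m = << m' >> & forall j,
    m' j = (\sum_(i <- finsupp m) (g i == j) * m i)%N.
  rewrite E; congr << _ >>; apply: monoP => j; rewrite m'E mactE //.
  have [h|h] := boolP (s j \in finsupp m).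
    rewrite (big_fsetD1 _ h) /= sK eqxx mul1n big1_fset ?addn0 // => i.
    rewrite !inE => /andP[ij _] _; case: eqP => // E'; case/eqP: ij.
    by rewrite -E' gK.
  rewrite big1_fset; first by move: h; rewrite -cmE_eq0 => /eqP.
  move=> i ih _; case: eqP => // E'; case/negP: h; by rewrite -E' gK.
rewrite /hmon; elim: (enum_fset (finsupp m)) => [|i r [m' E m'E]].
  by exists mone => [|j]; rewrite big_nil // cm1.
have [m'' E' m''E] := varX_mono (g i) (m i).
exists (mmul m'' m') => [|j]; last by rewrite big_cons cmM m'E m''E.
rewrite big_cons E E'; exact: malgU1M.
Qed.

Lemma rename_coef s g f m : cancel s g -> cancel g s ->
  (rename g f)@_m = f@_(mact g s m).
Proof.
move=> sK gK; rewrite renameE mmapE raddf_sum /=.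
under eq_bigr do rewrite mcoeffCM (hmonE _ sK gK) mcoeffU1.
have E k : (mact s g k == m) = (k == mact g s m).
  by apply/eqP/eqP => [<-|->]; rewrite mactK.
have [h|h] := boolP (mact g s m \in msupp f).
  rewrite (big_fsetD1 _ h) /= E eqxx mulr1 big1_fset ?addr0 // => k.
  by rewrite !inE => /andP[/negbTE km _] _; rewrite E km mulr0.
rewrite (mcoeff_outdom h) big1_fset // => k kf _; rewrite E.
by case: eqP kf => [->|]; rewrite ?mulr0 // (negbTE h).
Qed.

Lemma rename_swap_coef j f m : (rename (simple_refl j) f)@_m = f@_(mswap j m).
Proof. by apply: rename_coef; apply: simple_reflK. Qed.

(** The series x_i G; it serves polynomials, through their coefficient functions, as well as
    series. *)
Definition mulx (i : int) (G : series) : series :=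
  fun m => if (0 < m i)%N then G (mdivx m i) else 0.

Lemma mulxU i G m : mulx i G (mmul (ucm i) m) = G m.
Proof. by rewrite /mulx cmM cmUU mulxK. Qed.

Lemma mcoeff_varM i f m : (var i * f)@_m = mulx i (mcoeff^~ f) m.
Proof.
rewrite /mulx [var i * f](@fgmulUg _ rat 1 (ucm i) f) raddf_sum /=.
under eq_bigr do rewrite mul1r mcoeffU -[_ *+ (_ == _)]mulr_natr.
case: ifP => [mi|/negbT mi]; last first.
  rewrite big1 // => k _; case: eqP => [E|]; last by rewrite mulr0.
  by move: mi; rewrite -E cmM cmUU.
have E k : (mmul (ucm i) k == m) = (k == mdivx m i).
  by apply/eqP/eqP => [<-|->]; rewrite ?mulxK ?mdivxK.
have [h|h] := boolP (mdivx m i \in msupp f).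
  rewrite (big_fsetD1 _ h) /= E eqxx mulr1 big1_fset ?addr0 // => k.
  by rewrite !inE => /andP[/negbTE km _] _; rewrite E km mulr0.
rewrite (mcoeff_outdom h) big1_fset // => k kf _; rewrite E.
by case: eqP kf => [->|]; rewrite ?mulr0 // (negbTE h).
Qed.

Lemma mcoeff_varBM i j (g : poly_Z) m :
  ((var i - var j) * g)@_m = mulx i (mcoeff^~ g) m - mulx j (mcoeff^~ g) m.
Proof.
rewrite mulrBl; apply: etrans (mcoeffB _ _ _) _.
by congr (_ - _); apply: mcoeff_varM.
Qed.

(** The relation (x_j - x_(j+1)) G = F - s_j F read on coefficients. At each monomial it involves
    finitely many coefficients, so it passes to coefficientwise limits. *)
Definition is_divdiff (j : int) (F G : series) : Prop :=
  forall m, F m - F (mswap j m) = mulx j G m - mulx (j + 1) G m.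

Lemma is_divdiff_poly j (f g : poly_Z) :
  (var j - var (j + 1)) * g = f - rename (simple_refl j) f ->
  is_divdiff j (mcoeff^~ f) (mcoeff^~ g).
Proof.
move=> E m; have R : (f - rename (simple_refl j) f)@_m = f@_m - f@_(mswap j m).
  by apply: etrans (mcoeffB _ _ _) _; congr (_ - _); apply: rename_swap_coef.
exact: etrans (esym R) (etrans (esym (congr1 (mcoeff m) E)) (mcoeff_varBM _ _ _ _)).
Qed.

(* A coefficient of G is read off along the string x_i (x_i / x_j)^t, t >= 0. *)
Lemma divdiff_support i j (G H : series) m : i != j ->
  (forall m, mulx i G m - mulx j G m = H m) -> G m != 0 ->
  exists2 m' : mono, H m' != 0 & exists t, forall k,
    (m' k + t * (k == j) = m k + t.+1 * (k == i))%N.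
Proof.
move=> ij GH; move: {2}(m j) (erefl (m j)) => n.
elim: n m => [|n IH] m mj Gm.
  exists (mmul (ucm i) m); last by exists 0%N => k; rewrite cmM cmU; lia.
  by rewrite -GH mulxU /mulx cmM cmU mj (negbTE ij) /= subr0.
(* If H vanishes at x_i m, then G takes the same value at m and at x_i m / x_j, whose exponent of
   x_j is smaller. *)
have [h|h] := eqVneq (H (mmul (ucm i) m)) 0; last first.
  by exists (mmul (ucm i) m) => //; exists 0%N => k; rewrite cmM cmU; lia.
have [||m' Hm' [t m'E]] := IH (mdivx (mmul (ucm i) m) j).
- by rewrite mdivxE cmM cmU eqxx (negbTE ij) mj; lia.
- move: h; rewrite -GH mulxU /mulx cmM cmU (negbTE ij) mj /= => /eqP.
  by rewrite subr_eq0 => /eqP <-.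
exists m' => //; exists t.+1 => k; have := m'E k.
rewrite mdivxE cmM cmU; have [<-|kj] := eqVneq j k; last first.
  by rewrite (eq_sym i k); lia.
by rewrite (negbTE ij) mj (eq_sym j i) (negbTE ij); lia.
Qed.

Lemma addr1_neq (j : int) : j != j + 1.
Proof. lia. Qed.

(** A nonzero coefficient of f would, by [divdiff_support], produce a nonzero coefficient of the
    product. *)
Lemma divdiff_cancel i j (f : poly_Z) : i != j -> (var i - var j) * f = 0 -> f = 0.
Proof.
move=> ij E; apply/malgP => m; apply/eqP; rewrite mcoeff0; apply/negPn/negP => fm.
have H k : mulx i (mcoeff^~ f) k - mulx j (mcoeff^~ f) k = 0.
  exact: etrans (esym (mcoeff_varBM _ _ _ _)) (etrans (congr1 (mcoeff k) E) (mcoeff0 _)).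
by have [m' /eqP] := divdiff_support ij H fm.
Qed.

Lemma divdiff_inj i j (f g : poly_Z) : i != j ->
  (var i - var j) * f = (var i - var j) * g -> f = g.
Proof.
move=> ij /eqP; rewrite -subr_eq0 -mulrBr => /eqP/(divdiff_cancel ij)/eqP.
by rewrite subr_eq0 => /eqP.
Qed.

Definition has_divdiff j (f : poly_Z) :=
  exists g : poly_Z, (var j - var (j + 1)) * g = f - rename (simple_refl j) f.

(** * Leibniz rule and Coxeter relations for divided differences *)

Section TwistedLeibniz.
Variable R : comPzRingType.
Implicit Types a b c d f p q x y z : R.

Lemma divdiff_eqD d p q f f' sf sf' : d * p = f - sf -> d * q = f' - sf' ->
  d * (p + q) = (f + f') - (sf + sf').
Proof. by move=> E E'; rewrite mulrDr E E' opprD addrACA. Qed.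

Lemma divdiff_eqM d p q f f' sf sf' : d * p = f - sf -> d * q = f' - sf' ->
  d * (p * f' + sf * q) = f * f' - sf * sf'.
Proof.
move=> E E'; rewrite mulrDr mulrA E mulrCA E' mulrBl mulrBr.
by rewrite addrA subrK.
Qed.

Lemma divdiff_eq_sym x y p sp f sf : (x - y) * p = f - sf -> (y - x) * sp = sf - f ->
  (x - y) * sp = (x - y) * p.
Proof. by move=> -> E; rewrite -opprB mulNr E opprB. Qed.

Lemma addrACA_sub a b c d : a - b - (c - d) = a - c - (b - d).
Proof. by rewrite !opprB addrACA [RHS]addrACA [- c - b]addrC. Qed.

Variables s t : R -> R.
Hypotheses (sM : {morph s : x y / x * y}) (sB : {morph s : x y / x - y}).
Hypotheses (tM : {morph t : x y / x * y}) (tB : {morph t : x y / x - y}).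

Lemma divdiff_eq_comm a b f p q : s b = b ->
  b * p = f - t f -> a * q = p - s p ->
  b * (a * q) = (f - t f) - (s f - s (t f)).
Proof. by move=> sb E1 E2; rewrite E2 mulrBr E1 -{1}sb -sM E1 sB. Qed.

(** Multiplied by the three differences of x, y, z, the threefold divided difference is the
    alternating sum of f over the words 1, s, t, ts, st, sts. *)
Lemma divdiff_eq_braid x y z f p1 p2 p3 :
  s x = y -> s y = x -> s z = z -> t x = x -> t y = z -> s p1 = p1 ->
  (x - y) * p1 = f - s f -> (y - z) * p2 = p1 - t p1 -> (x - y) * p3 = p2 - s p2 ->
  (x - y) * ((x - z) * ((y - z) * p3)) =
  (f - s f) - (t f - t (s f)) + (s (t f) - s (t (s f))).
Proof.
move=> sx sy sz tx ty sp1 E1 E2 E3.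
have E2s : (x - z) * s p2 = p1 - s (t p1).
  by have := congr1 s E2; rewrite sM !sB sy sz sp1.
have E1t : (x - z) * t p1 = t f - t (s f).
  by have := congr1 t E1; rewrite tM !tB tx ty.
have E1st : (y - z) * s (t p1) = s (t f) - s (t (s f)).
  by have := congr1 s E1t; rewrite sM !sB sx sz.
rewrite -E1 -E1t -E1st mulrCA [X in _ * X]mulrCA E3 2!mulrBr E2.
rewrite [X in _ - X]mulrCA E2s 2!mulrBr.
have -> : (x - y) * p1 = (x - z) * p1 - (y - z) * p1 by rewrite -mulrBl opprB addrA subrK.
by rewrite opprB [X in _ = X + _]addrAC -[RHS]addrA; congr (_ + _); rewrite addrC.
Qed.
End TwistedLeibniz.

(** Exchanging s and t reverses the order of the variables; the alternating sum is unchanged because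
    sts and tst agree on f. *)
Lemma divdiff_eq_braid_sym (R : comPzRingType) (s t : R -> R) (x y z f p1 p2 p3 q1 q2 q3 : R) :
  {morph s : x y / x * y} -> {morph s : x y / x - y} ->
  {morph t : x y / x * y} -> {morph t : x y / x - y} ->
  s x = y -> s y = x -> s z = z -> t x = x -> t y = z -> t z = y ->
  s p1 = p1 -> t q1 = q1 -> s (t (s f)) = t (s (t f)) ->
  (x - y) * p1 = f - s f -> (y - z) * p2 = p1 - t p1 -> (x - y) * p3 = p2 - s p2 ->
  (y - z) * q1 = f - t f -> (x - y) * q2 = q1 - s q1 -> (y - z) * q3 = q2 - t q2 ->
  (x - y) * ((x - z) * ((y - z) * p3)) = (x - y) * ((x - z) * ((y - z) * q3)).
Proof.
move=> sM sB tM tB sx sy sz tx ty tz sp tq st Ep1 Ep2 Ep3 Eq1 Eq2 Eq3.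
have mN (u : R -> R) : {morph u : x y / x - y} -> {morph u : x / - x}.
  move=> uB a; have u0 : u 0 = 0 by have := uB 0 0; rewrite !subrr.
  by have := uB 0 a; rewrite u0 !sub0r.
have sN := mN s sB; have tN := mN t tB.
have NB (a b : R) : - a - - b = b - a by rewrite opprK addrC.
rewrite (divdiff_eq_braid sM sB tM tB sx sy sz tx ty sp Ep1 Ep2 Ep3).
(* Negating the reversed variables restores the signs: (-z) - (-y) = y - z. *)
have L := @divdiff_eq_braid R t s tM tB sM sB (- z) (- y) (- x) f q1 q2 q3.
rewrite !tN !sN tx ty tz sy sz !NB in L.
have -> : (x - y) * ((x - z) * ((y - z) * q3)) = (y - z) * ((x - z) * ((x - y) * q3)).
  by rewrite mulrCA [X in _ * X]mulrCA [RHS]mulrCA.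
rewrite L // st !opprB !addrA; congr (_ - _).
by rewrite -!addrA; congr (_ + _); rewrite addrA [LHS]addrC !addrA.
Qed.

Lemma has_divdiffD j (f f' : poly_Z) :
  has_divdiff j f -> has_divdiff j f' -> has_divdiff j (f + f').
Proof.
move=> [g E] [g' E']; exists (g + g').
by apply: etrans (divdiff_eqD E E') _; congr (_ - _); rewrite renameD.
Qed.

Lemma has_divdiffM j (f f' : poly_Z) :
  has_divdiff j f -> has_divdiff j f' -> has_divdiff j (f * f').
Proof.
move=> [g E] [g' E']; exists (g * f' + rename (simple_refl j) f * g').
by apply: etrans (divdiff_eqM E E') _; congr (_ - _); apply/esym/renameM.
Qed.

Lemma has_divdiff1 j : has_divdiff j 1.
Proof. by exists 0; rewrite mulr0 rename1 subrr. Qed.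

Lemma has_divdiff_var j i : has_divdiff j (var i).
Proof.
rewrite /has_divdiff rename_var; have [[-> ->]|[[-> ->]|[_ [_ ->]]]] := simple_refl_spec j i.
- by exists 1; rewrite mulr1.
- by exists (- 1); rewrite mulrN1 opprB.
- by exists 0; rewrite mulr0 subrr.
Qed.

Lemma has_divdiffX j f n : has_divdiff j f -> has_divdiff j (f ^+ n).
Proof.
move=> h; elim: n => [|n IH]; first exact: has_divdiff1.
by rewrite exprS; apply: has_divdiffM.
Qed.

(** The quotient is exact for constants and variables, and exactness is preserved by sums and,
    through the twisted Leibniz rule, by products. *)
Lemma divdiffP j f :
  (var j - var (j + 1)) * divdiff j f = f - rename (simple_refl j) f.
Proof.
suff : has_divdiff j f by move=> /(xgetPex 0).
rewrite (monalgE f); apply: (big_ind (has_divdiff j)).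
- by exists 0; rewrite mulr0 rename0 subrr.
- by move=> *; apply: has_divdiffD.
move=> m _; rewrite (_ : << _ *g m >> = (f@_m)%:MP * hmon id m).
  apply: has_divdiffM; first by exists 0; rewrite mulr0 renameC subrr.
  apply: (big_ind (has_divdiff j)); first exact: has_divdiff1.
    by move=> *; apply: has_divdiffM.
  by move=> i _; apply: has_divdiffX; apply: has_divdiff_var.
have mE : mact id id m = m by apply: monoP => i; rewrite mactE.
by rewrite (@hmonE id id) // mE; apply/esym/malgCU.
Qed.

Lemma divdiffE j (f g : poly_Z) :
  (var j - var (j + 1)) * g = f - rename (simple_refl j) f -> divdiff j f = g.
Proof.
move=> E; apply: (divdiff_inj (addr1_neq j)).
exact: etrans (divdiffP j f) (esym E).
Qed.

Lemma renameK s g f : cancel s g -> cancel g s -> rename g (rename s f) = f.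
Proof.
move=> sK gK; apply/malgP => m; apply: etrans (rename_coef _ _ sK gK) _.
by apply: etrans (rename_coef _ _ gK sK) _; rewrite mactK.
Qed.

Lemma rename_comp s g s' g' f : cancel s g -> cancel g s -> cancel s' g' -> cancel g' s' ->
  rename g (rename g' f) = rename (g \o g') f.
Proof.
move=> sK gK sK' gK'; apply/malgP => m; apply: etrans (rename_coef _ _ sK gK) _.
apply: etrans (rename_coef _ _ sK' gK') _; apply/esym.
have K1 : cancel (s' \o s) (g \o g') by apply: can_comp.
have K2 : cancel (g \o g') (s' \o s) by apply: can_comp.
apply: etrans (rename_coef _ _ K1 K2) _; congr (mcoeff _ _).
by apply: monoP => i; rewrite !mactE.
Qed.

Lemma rename_refl_comp i j f : rename (simple_refl i) (rename (simple_refl j) f) =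
  rename (simple_refl i \o simple_refl j) f.
Proof. by apply: rename_comp; apply: simple_reflK. Qed.

(** Applying s_j to the defining equation changes the sign of x_j - x_(j+1) and of f - s_j f. *)
Lemma rename_divdiff j f : rename (simple_refl j) (divdiff j f) = divdiff j f.
Proof.
apply: (divdiff_inj (addr1_neq j)); apply: divdiff_eq_sym (divdiffP j f) _.
have sd : rename (simple_refl j) (var j - var (j + 1)) = var (j + 1) - var j.
  by apply: etrans (rename_varB _ _ _) _; rewrite simple_reflL simple_reflR.
apply: etrans (congr1 ( *%R^~ _) (esym sd)) _; apply: etrans (esym (renameM _ _ _)) _.
apply: etrans (congr1 (rename _) (divdiffP j f)) _; apply: etrans (renameB _ _ _) _.
by congr (_ - _); apply: renameK; apply: simple_reflK.
Qed.

(** Multiplied by (x_i - x_(i+1)) (x_j - x_(j+1)), both sides become f - s_i f - s_j f + s_i s_j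
    f. *)
Lemma divdiff_comm i j f : i + 1 < j -> divdiff i (divdiff j f) = divdiff j (divdiff i f).
Proof.
move=> ij; have fixd k l : simple_refl k l = l -> simple_refl k (l + 1) = l + 1 ->
    rename (simple_refl k) (var l - var (l + 1)) = var l - var (l + 1).
  by move=> e1 e2; exact: etrans (rename_varB _ _ _) (f_equal2 (fun x y => var x - var y) e1 e2).
have sa := fixd j i ltac:(simple_refl_lia) ltac:(simple_refl_lia).
have sb := fixd i j ltac:(simple_refl_lia) ltac:(simple_refl_lia).
apply: (divdiff_inj (addr1_neq i)); apply: (divdiff_inj (addr1_neq j)).
have L := divdiff_eq_comm (@renameM _) (@renameB _) sb (divdiffP j f) (divdiffP i _).
have R := divdiff_eq_comm (@renameM _) (@renameB _) sa (divdiffP i f) (divdiffP j _).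
apply: etrans L _; apply/esym; apply: etrans (mulrCA _ _ _) _; apply: etrans R _.
rewrite !rename_refl_comp (simple_refl_comm ij).
exact: addrACA_sub.
Qed.

Lemma divdiff_braid i (f : poly_Z) :
  divdiff i (divdiff (i + 1) (divdiff i f)) =
  divdiff (i + 1) (divdiff i (divdiff (i + 1) f)).
Proof.
have ac : i != i + 1 + 1 by lia.
apply: (divdiff_inj (addr1_neq (i + 1))); apply: (divdiff_inj ac).
apply: (divdiff_inj (addr1_neq i)).
apply: (@divdiff_eq_braid_sym poly_Z (rename (simple_refl i)) (rename (simple_refl (i + 1)))
  (var i) (var (i + 1)) (var (i + 1 + 1)) f (divdiff i f) _ _ (divdiff (i + 1) f)).
- exact: renameM.
- exact: renameB.
- exact: renameM.
- exact: renameB.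
- by rewrite rename_var simple_reflL.
- by rewrite rename_var simple_reflR.
- by rewrite rename_var; congr var; simple_refl_lia.
- by rewrite rename_var; congr var; simple_refl_lia.
- by rewrite rename_var simple_reflL.
- by rewrite rename_var simple_reflR.
- exact: rename_divdiff.
- exact: rename_divdiff.
- have K j k : cancel (simple_refl j \o simple_refl k) (simple_refl k \o simple_refl j).
    by apply: can_comp; apply: simple_reflK.
  have E k l : rename (simple_refl k) (rename (simple_refl l) (rename (simple_refl k) f)) =
      rename (simple_refl k \o (simple_refl l \o simple_refl k)) f.
    have E1 := rename_refl_comp l k f; have E2 := rename_comp f (@simple_reflK k)
      (@simple_reflK k) (K k l) (K l k).
    exact (etrans (congr1 (rename (simple_refl k)) E1) E2).
  have C : simple_refl i \o (simple_refl (i + 1) \o simple_refl i) =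
      simple_refl (i + 1) \o (simple_refl i \o simple_refl (i + 1)) := simple_refl_braid i.
  exact (etrans (E i (i + 1)) (etrans (congr1 (rename^~ f) C) (esym (E (i + 1) i)))).
- exact: divdiffP.
- exact: divdiffP.
- exact: divdiffP.
- exact: divdiffP.
- exact: divdiffP.
- exact: divdiffP.
Qed.

(** * Schubert polynomials *)

Implicit Types (k : int) (u w : int -> int).

Lemma mulx_divdiff_eq (x y q : poly_Z) : (x - y) * q = x * q - y * q.
Proof. exact: mulrBl. Qed.

Definition monX i (t : nat) : mono := iter t (mmul (ucm i)) mone.

Lemma monXE i t j : monX i t j = ((i == j) * t)%N.
Proof. by elim: t => [|t IH] /=; rewrite ?cm1 ?muln0 // cmM cmU IH mulnS. Qed.

Lemma mdeg_monX i t : mdeg (monX i t) = t.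
Proof. by elim: t => [|t IH] /=; rewrite ?mdeg1 // mdegM mdegU IH. Qed.

Lemma rename_swap_mono j m : rename (simple_refl j) << m >> = << mswap j m >>.
Proof.
apply/malgP => m'; apply: etrans (rename_swap_coef _ _ _) _; rewrite !mcoeffU1.
by congr (_%:R); congr nat_of_bool; apply/eqP/eqP => [->|<-]; rewrite mswapK.
Qed.

(* The staircase monomial x_1^(n-1) ... x_(n-1), divided by x_1 ... x_k. *)
Definition stair_mono (n k : nat) : mono :=
  [cmonom (n - absz i - (i <= k%:Z)%R)%N | i in [fset j%:Z | j in iota 1 n]]%M.

Lemma stair_monoE n (k : nat) j : stair_mono n k j =
  if (0 < j) && (j <= n%:Z) then (n - absz j - (j <= k%:Z)%R)%N else 0%N.
Proof.
rewrite cmE fsfun_fun (_ : (j \in _) = (0 < j) && (j <= n%:Z)) //.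
apply/imfsetP/idP => [[l /=]|h]; first by rewrite mem_iota => h ->; lia.
by exists (absz j) => /=; [rewrite mem_iota|]; lia.
Qed.

Definition staircase (n : nat) : poly_Z := \prod_(1 <= i < n) var i%:Z ^+ (n - i).

Lemma staircaseE n : staircase n = << stair_mono n 0 >>.
Proof.
have [m E mE] : exists2 m : mono, staircase n = << m >> & forall j,
    m j = (\sum_(1 <= i < n) (i%:Z == j) * (n - i))%N.
  rewrite /staircase; elim: (index_iota 1 n) => [|i r [m E mE]].
    by exists mone => [|j]; rewrite big_nil // cm1.
  have [m' E' m'E] := varX_mono i%:Z (n - i).
  exists (mmul m' m) => [|j]; last by rewrite big_cons cmM mE m'E.
  rewrite big_cons E E'; exact: malgU1M.
rewrite E; congr << _ >>; apply: monoP => j; rewrite mE stair_monoE.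
case: ifP => h.
  have [jn|jn] := boolP (j == n%:Z).
    rewrite big1_seq => [|i /andP[_]]; first by lia.
    by rewrite mem_index_iota; case: eqP => //; lia.
  rewrite (bigD1_seq (absz j)) ?iota_uniq ?mem_index_iota //=; last by lia.
  rewrite big1 => [|i ij]; last by case: eqP => //; lia.
  by rewrite (_ : (_ == j) = true); lia.
rewrite big1_seq // => i /andP[_]; rewrite mem_index_iota => h'.
by case: eqP => //; lia.
Qed.

(** A value obtained along one chain of divided differences from the top of S_n. It is a relation
    because the value depends a priori on the chain and on n; both dependences are removed below. *)
Inductive schubert_at (n : nat) : (int -> int) -> poly_Z -> Prop :=
| SchubertTop : schubert_at n (rev_perm n) (staircase n)
| SchubertStep u i f : S_fin n u -> 0 < i -> i < n%:Z -> u i < u (i + 1) ->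
    schubert_at n (u \o simple_refl i) f -> schubert_at n u (divdiff i f).

Lemma schubert_at_fin n u f : schubert_at n u f -> S_fin n u.
Proof. by case=> [|*] //; apply: S_fin_rev. Qed.

Lemma schubert_atP n u f : schubert_at n u f ->
  (u = rev_perm n /\ f = staircase n) \/
  exists i f', [/\ 0 < i, i < n%:Z, u i < u (i + 1),
    schubert_at n (u \o simple_refl i) f' & f = divdiff i f'].
Proof. by case=> [|{}u i {}f _ *]; [left|right; exists i, f]. Qed.

(** Induction on the number of inversions that u lacks in comparison with the longest element; an
    ascent of u leads one step up. *)
Lemma schubert_at_exists n u : S_fin n u -> exists f, schubert_at n u f.
Proof.
move: {2}(inv_number _ - _)%N (erefl (inv_number (rev_perm n) - inv_number u))%N => d.
elim: d u => [|d IH] u du uS.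
  have [->|/(S_fin_ascent uS)[i [i0 ilt a]]] := pselect (u = rev_perm n).
    by exists (staircase n); constructor.
  have := inv_number_rev_max (S_fin_comp uS i0 ilt).
  by rewrite (inv_number_asc uS.1.1 a); lia.
have [->|/(S_fin_ascent uS)[i [i0 ilt a]]] := pselect (u = rev_perm n).
  by exists (staircase n); constructor.
have uS' := S_fin_comp uS i0 ilt.
have [|f uf] := IH (u \o simple_refl i) _ uS'.
  by rewrite (inv_number_asc uS.1.1 a); lia.
by exists (divdiff i f); apply: SchubertStep uf.
Qed.

(* The divided differences satisfy the Coxeter relations, so two descending
   paths out of a permutation can be completed to a common one. *)
Lemma schubert_at_unique n u f f' : schubert_at n u f -> schubert_at n u f' -> f = f'.
Proof.
move: {2}(inv_number _ - _)%N (leqnn (inv_number (rev_perm n) - inv_number u))%N => d.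
elim: d u f f' => [|d IH] u f f' du uf uf'; have uS := schubert_at_fin uf.
  have [[_ ->]|[i [g [i0 ilt a _ _]]]] := schubert_atP uf; last first.
    have := inv_number_rev_max (S_fin_comp uS i0 ilt).
    by rewrite (inv_number_asc uS.1.1 a); lia.
  have [[_ ->] //|[i [g [i0 ilt a _ _]]]] := schubert_atP uf'.
  have := inv_number_rev_max (S_fin_comp uS i0 ilt).
  by rewrite (inv_number_asc uS.1.1 a); lia.
have IHu i g g' : 0 < i -> i < n%:Z -> u i < u (i + 1) ->
    schubert_at n (u \o simple_refl i) g -> schubert_at n (u \o simple_refl i) g' -> g = g'.
  move=> i0 ilt a; apply: IH.
  have := inv_number_rev_max (S_fin_comp uS i0 ilt).
  by rewrite (inv_number_asc uS.1.1 a); lia.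
have diamond i j g g' : i < j -> 0 < i -> j < n%:Z -> u i < u (i + 1) -> u j < u (j + 1) ->
    schubert_at n (u \o simple_refl i) g -> schubert_at n (u \o simple_refl j) g' ->
    divdiff i g = divdiff j g'.
  move=> ij i0 jn ai aj ug ug'; have uiS := schubert_at_fin ug; have ujS := schubert_at_fin ug'.
  have [j0 ilt] : 0 < j /\ i < n%:Z by lia.
  have [ij1|ij1] := ltP (i + 1) j.
    have uijS := S_fin_comp uiS j0 jn.
    have [h uh] := schubert_at_exists uijS.
    have fi : simple_refl i j = j /\ simple_refl i (j + 1) = j + 1 by split; simple_refl_lia.
    have fj : simple_refl j i = i /\ simple_refl j (i + 1) = i + 1 by split; simple_refl_lia.
    (* [h] is a value at u s_i s_j = u s_j s_i, so by induction g and g' are divided differences of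
       it. *)
    have -> : g = divdiff j h.
      by apply: IHu ug _ => //; apply: SchubertStep => //=; rewrite fi.1 fi.2.
    have -> : g' = divdiff i h.
      apply: IHu ug' _ => //; apply: SchubertStep => //=; first by rewrite fj.1 fj.2.
      by rewrite -compA -simple_refl_comm.
    exact: divdiff_comm.
  have {ij1} jE : j = i + 1 by lia.
  subst j.
  have uijS := S_fin_comp uiS j0 jn; have ujiS := S_fin_comp ujS i0 ilt.
  have uijiS := S_fin_comp uijS i0 ilt.
  have [h uh] := schubert_at_exists uijiS.
  have s1 : simple_refl i (i + 1 + 1) = i + 1 + 1 by simple_refl_lia.
  have s2 : simple_refl (i + 1) i = i by simple_refl_lia.
  (* Here [h] is a value at u s_i s_(i+1) s_i, where the two sides of the hexagon meet. *)
  have -> : g = divdiff (i + 1) (divdiff i h).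
    apply: IHu ug _ => //; apply: SchubertStep => //=; first by rewrite simple_reflR s1; lia.
    by apply: SchubertStep => //=; rewrite s2 !simple_reflL s1.
  have -> : g' = divdiff i (divdiff (i + 1) h).
    apply: IHu ug' _ => //; apply: SchubertStep => //=; first by rewrite simple_reflL s2; lia.
    apply: SchubertStep => //=; first by rewrite s1 simple_reflR simple_reflR s2.
    have E := congr1 (fun v => u \o v) (esym (simple_refl_braid i)).
    exact (eq_ind_r (fun v => schubert_at n v h) uh E).
  exact: divdiff_braid.
have [[ur ->]|[i [g [i0 ilt ai ug ->]]]] := schubert_atP uf.
  have [[_ ->] //|[j [g' [j0 jlt aj ug' ->]]]] := schubert_atP uf'.
  by move: aj; rewrite ur; have := rev_perm_descent j0 jlt; lia.
have [[ur ->]|[j [g' [j0 jlt aj ug' ->]]]] := schubert_atP uf'.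
  by move: ai; rewrite ur; have := rev_perm_descent i0 ilt; lia.
have [ij|ij|ij] := ltgtP i j.
- exact: diamond ug ug'.
- by apply/esym; apply: diamond ug' ug.
- by subst j; rewrite (IHu i g g').
Qed.

(* The one-line notation n, ..., n-k+1, n+1, n-k, ..., 1, leading from
   [rev_perm n.+1] at k = 0 down to [rev_perm n] at k = n. *)
Definition rev_insert (n k : nat) : int -> int := fun j =>
  if (0 < j) && (j <= n%:Z + 1) then
    (if j <= k%:Z then n%:Z + 1 - j else if j == k%:Z + 1 then n%:Z + 1 else n%:Z + 2 - j)
  else j.

Lemma rev_insert0 n : rev_insert n 0 = rev_perm n.+1.
Proof.
apply/funext => j; rewrite /rev_insert /rev_perm.
by do ?[case: ifP => ?]; lia.
Qed.

Lemma rev_insertn n : rev_insert n n = rev_perm n.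
Proof.
apply/funext => j; rewrite /rev_insert /rev_perm.
by do ?[case: ifP => ?]; lia.
Qed.

Lemma rev_insertS n (k : nat) : (k < n)%N ->
  rev_insert n k.+1 = rev_insert n k \o simple_refl (k%:Z + 1).
Proof.
move=> kn; apply/funext => j; rewrite /rev_insert /=.
have [[-> ->]|[[-> ->]|[h1 [h2 ->]]]] := simple_refl_spec (k%:Z + 1) j;
  do ?[case: ifP => ?]; lia.
Qed.

(** The monomial at step k is x_(k+1) times the next one, which is invariant under s_(k+1), and the
    divided difference of x_(k+1) times an invariant is that invariant. At k = n the staircase
    monomial of S_n appears. *)
Lemma schubert_at_insert n (k : nat) : (k <= n)%N ->
  schubert_at n.+1 (rev_insert n k) << stair_mono n.+1 k >>.
Proof.
elim: k => [_|k IH kn]; first by rewrite rev_insert0 -staircaseE; constructor.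
have {}IH := IH (ltnW kn); have kS := schubert_at_fin IH.
have k0 : 0 < k%:Z + 1 by lia.
have kn' : k%:Z + 1 < n.+1%:Z by lia.
rewrite (_ : << _ >> = divdiff (k%:Z + 1) << stair_mono n.+1 k >>).
  apply: SchubertStep => //; last by rewrite rev_insertS // comp_simple_reflK.
    by rewrite rev_insertS //; apply: S_fin_comp.
  rewrite rev_insertS //= simple_reflL simple_reflR /rev_insert.
  by do ?[case: ifP => ?]; lia.
apply/esym/divdiffE.
set i := k%:Z + 1; set m := stair_mono n.+1 k.+1.
have sm : mswap i m = m.
  apply: monoP => j; rewrite mswapE !stair_monoE /i.
  have [[-> ->]|[[-> ->]|[h1 [h2 ->]]]] // := simple_refl_spec (k%:Z + 1) j;
    do ?[case: ifP => ?]; lia.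
have mE : stair_mono n.+1 k = mmul (ucm i) m.
  apply: monoP => j; rewrite cmM cmU !stair_monoE /i.
  by case: eqP => [<-|h] /=; do ?[case: ifP => ?]; lia.
have m2E : mswap i (mmul (ucm i) m) = mmul (ucm (i + 1)) m.
  rewrite /mswap mactM; last exact: simple_reflK.
  rewrite mactU; [|exact: simple_reflK|exact: simple_reflK].
  by rewrite simple_reflL -/(mswap i m) sm.
apply: etrans (mulx_divdiff_eq _ _ _) _; rewrite mE; congr (_ - _).
  exact: malgU1M.
by apply/esym; apply: etrans (rename_swap_mono _ _) _; rewrite m2E; apply/esym/malgU1M.
Qed.

Lemma schubert_atS n u f : schubert_at n u f -> schubert_at n.+1 u f.
Proof.
elim=> [|{}u i {}f uS i0 ilt a _ IH]; last first.
  by apply: SchubertStep IH => //; [apply: S_fin_ge uS|lia].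
have := schubert_at_insert (leqnn n); rewrite rev_insertn staircaseE.
rewrite (_ : stair_mono n.+1 n = stair_mono n 0) //.
by apply: monoP => j; rewrite !stair_monoE; do ?[case: ifP => ?]; lia.
Qed.

Lemma schubert_at_ge n n' u f : (n <= n')%N -> schubert_at n u f -> schubert_at n' u f.
Proof.
move=> /subnK <-; elim: (n' - n)%N => // d IH h.
by rewrite addSn; apply/schubert_atS/IH.
Qed.

Lemma schubert_at_unique2 n n' u f f' :
  schubert_at n u f -> schubert_at n' u f' -> f = f'.
Proof.
move=> /(schubert_at_ge (leq_maxl n n')) h /(schubert_at_ge (leq_maxr n n')).
exact: schubert_at_unique.
Qed.

Lemma is_schubert_at Sch n u f : is_schubert Sch -> schubert_at n u f -> Sch u = f.
Proof.
move=> [top desc]; elim=> [|{}u i {}f uS i0 ilt a uf IH].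
  by rewrite (top n) //; apply: rev_perm_longest.
have uiS := schubert_at_fin uf.
rewrite -IH desc ?comp_simple_reflK //; first exact: uiS.1.
rewrite -{1}(comp_simple_reflK i u) coxeter_length_desc; last exact: uiS.1.1.
by rewrite /= simple_reflL simple_reflR.
Qed.

Lemma schubert_exists : exists Sch, is_schubert Sch.
Proof.
pose Sch u : poly_Z := xget 0 [set f | exists n, schubert_at n u f].
have SchE n u f : schubert_at n u f -> Sch u = f.
  move=> uf; have : exists f, [set f | exists n, schubert_at n u f] f by exists f, n.
  by move=> /(xgetPex 0)[n' uf']; apply: schubert_at_unique2 uf' uf.
exists Sch; split => [n w0 /longest_eq ->|u i uS].
  by apply: SchE; constructor.
rewrite coxeter_length_desc; last exact: uS.1.
move=> d; have i0 := S_infty_descent uS d.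
have [n un] := S_infty_fin uS; have {}un : S_fin (n + absz i).+1 u by apply: S_fin_ge un; lia.
have [f uf] := schubert_at_exists un; rewrite (SchE _ _ _ uf).
apply/esym; apply: (SchE (n + absz i).+1); have ilt : i < (n + absz i).+1%:Z by lia.
apply: SchubertStep => //; first exact: S_fin_comp.
  by rewrite /= simple_reflL simple_reflR.
by rewrite comp_simple_reflK.
Qed.

Lemma schubertP : is_schubert schubert.
Proof. exact: (xgetPex (fun=> 0) schubert_exists). Qed.

Lemma schubert_atE n u : S_fin n u -> schubert_at n u (schubert u).
Proof.
by move=> /schubert_at_exists[f uf]; rewrite (is_schubert_at schubertP uf).
Qed.

(** * The stable limit *)

Definition schubert_coef (u : int -> int) : series := fun m => (schubert u)@_m.

(** The expected divided difference at j of the member of the family F indexed by u; it is zero at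
    an ascent, where that member should be symmetric in x_j and x_(j+1). *)
Definition at_descent (F : (int -> int) -> series) (u : int -> int) (j : int) : series :=
  if u (j + 1) < u j then F (u \o simple_refl j) else fun=> 0.

Lemma mulx0 j m : mulx j (fun=> 0) m = 0.
Proof. by rewrite /mulx; case: ifP. Qed.

Lemma schubert_desc u j : S_infty u -> u (j + 1) < u j ->
  divdiff j (schubert u) = schubert (u \o simple_refl j).
Proof.
move=> uS d; apply: (schubertP.2 u j uS); rewrite coxeter_length_desc //.
exact: uS.1.
Qed.

(** At an ascent j the polynomial of u is itself the divided difference of that of u s_j, hence
    symmetric. Positivity of j keeps u s_j in [S_infty]. *)
Lemma schubert_is_divdiff u j : S_infty u -> 0 < j ->
  is_divdiff j (schubert_coef u) (at_descent schubert_coef u j).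
Proof.
move=> uS j0; rewrite /at_descent; case: ifP => [d|/negP/(S_Z_asc_or_desc uS.1) a].
  by have := is_divdiff_poly (divdiffP j (schubert u)); rewrite (schubert_desc uS d).
have E : rename (simple_refl j) (schubert u) = schubert u.
  have us : S_infty (u \o simple_refl j) by apply: S_infty_comp.
  have <- : divdiff j (schubert (u \o simple_refl j)) = schubert u.
    rewrite schubert_desc ?comp_simple_reflK //.
    by rewrite /= simple_reflL simple_reflR.
  exact: rename_divdiff.
move=> m; rewrite !mulx0 subrr /schubert_coef -{1}E.
by apply/eqP; rewrite subr_eq0; apply/eqP/rename_swap_coef.
Qed.

(** Each divided difference lowers degree and length by one. The degree of the staircase and the
    length of the top element stay uncomputed: [schubert_supp] eliminates them by comparison with
    the identity. *)
Lemma schubert_at_supp n u (f : poly_Z) m : schubert_at n u f -> f@_m != 0 ->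
  (forall k, k <= 0 -> m k = 0%N) /\
  (mdeg m + inv_number (rev_perm n) = mdeg (stair_mono n 0) + inv_number u)%N.
Proof.
move=> uf; elim: uf m => [|{}u i {}f uS i0 ilt a uf IH] m.
  rewrite staircaseE mcoeffU1; case: (stair_mono n 0 =P m) => [<- _|]; last by rewrite eqxx.
  by split => // k k0; rewrite stair_monoE; case: ifP => //; lia.
move=> fm; have H (l : mono) : mulx i (mcoeff^~ (divdiff i f)) l -
    mulx (i + 1) (mcoeff^~ (divdiff i f)) l = f@_l - f@_(mswap i l) by have := is_divdiff_poly (divdiffP i f) l.
(* A coefficient of the divided difference is traced to one of f - s_i f, at m' = m x_i (x_i /
   x_(i+1))^t, hence to one of f at m' or at its swap. *)
have [m' Hm' [t m'E]] := divdiff_support (addr1_neq i) H fm.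
have {Hm'} [m'' fm'' m''E] : exists2 m'' : mono, f@_m'' != 0 & m'' = m' \/ m'' = mswap i m'.
  have [h|h] := eqVneq (f@_m') 0; last by exists m' => //; left.
  exists (mswap i m'); last by right.
  by move: Hm'; rewrite h sub0r oppr_eq0.
have [v d] := IH _ fm''.
have dm : mdeg m'' = mdeg m' by case: m''E => -> //; apply: mdeg_mact; apply: simple_reflK.
have vm k : k <= 0 -> m' k = 0%N.
  move=> k0; have := v k k0; case: m''E => -> //; rewrite mswapE.
  by rewrite (_ : simple_refl i k = k) //; simple_refl_lia.
split=> [k k0|].
  have := m'E k; rewrite (vm k k0) (_ : (k == i) = false); last by lia.
  by rewrite (_ : (k == i + 1) = false) ?muln0; lia.
have : mdeg (mmul m' (monX (i + 1) t)) = mdeg (mmul m (monX i t.+1)).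
  congr mdeg; apply: monoP => k; rewrite (cmM k m') (cmM k m) !monXE.
  by rewrite (eq_sym i k) (eq_sym (i + 1) k) [(_ * t)%N]mulnC [(_ * t.+1)%N]mulnC m'E.
rewrite (mdegM m') (mdegM m) !mdeg_monX.
by have := inv_number_asc uS.1.1 a; move: d; rewrite dm; lia.
Qed.

Lemma schubert_id : schubert id = 1.
Proof.
have -> : id = rev_perm 0.
  by apply/funext => j; rewrite rev_perm_out //; lia.
rewrite (is_schubert_at schubertP (SchubertTop 0)).
by rewrite /staircase big_nil.
Qed.

Lemma S_fin_id n : S_fin n id.
Proof. by do 2!split=> //; exact: S_Z_id. Qed.

Lemma schubert_supp u m : S_infty u -> schubert_coef u m != 0 ->
  (forall k, k <= 0 -> m k = 0%N) /\ mdeg m = inv_number u.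
Proof.
move=> /S_infty_fin[n un]; rewrite /schubert_coef => um.
have [v d] := schubert_at_supp (schubert_atE un) um; split => //.
have : (schubert id)@_(mone : mono) != 0 by rewrite schubert_id mcoeff1 eqxx oner_eq0.
move=> /(schubert_at_supp (schubert_atE (S_fin_id n)))[_].
by rewrite mdeg1 inv_number_id; lia.
Qed.

(* A coefficient function invariant under s_j for j >= a and vanishing on
   monomials involving large variables vanishes on those involving x_i, i >= a:
   the variable x_i can be pushed up. *)
Lemma pushup (D : series) (P : mono -> Prop) (a N : int) m i :
  (forall m j, a <= j -> P m -> P (mswap j m) /\ D (mswap j m) = D m) ->
  (forall m j, N <= j -> P m -> (0 < m j)%N -> D m = 0) ->
  P m -> a <= i -> (0 < m i)%N -> D m = 0.
Proof.
move=> sw big; have [Ni Pm _|iN] := leP N i; first exact: big.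
have {iN} [d dE] : exists d : nat, N = i + d%:Z by exists (absz (N - i)%R); lia.
elim: d i m dE => [|d IH] i m dE Pm ai mi; first by apply: (big m i) => //; lia.
have [Pm' <-] := sw m i ai Pm.
apply: (IH (i + 1)) => //; [lia|lia|by rewrite mswapE simple_reflR].
Qed.

(** There is no descent at i >= n, so the polynomial is invariant under these s_i when i > 0, and
    only finitely many variables occur in it. *)
Lemma schubert_bound n u m j : S_fin n u -> n%:Z <= j -> (0 < m j)%N ->
  schubert_coef u m = 0.
Proof.
move=> un nj mj; have uS := un.1; apply/eqP/negPn/negP => um.
have j0 : 0 < j.
  by rewrite ltNge; apply/negP => /(schubert_supp uS um).1 E; move: mj; rewrite E.
(* [N] exceeds every index that occurs in the polynomial. *)
pose N : nat := (\sum_(m <- msupp (schubert u)) \sum_(i <- finsupp m) absz i).+1.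
move/eqP: um; apply.
(* The maximum with 1 restricts the swaps to positive indices, where [schubert_is_divdiff]
   applies. *)
apply: (@pushup _ (fun=> True) (maxn n 1)%:Z N%:Z m j) => //; last by lia.
- move=> m' i ni _; split => //; have i0 : 0 < i by lia.
  have := schubert_is_divdiff uS i0 m'; rewrite /at_descent ifN.
    by rewrite !mulx0 subrr => /eqP; rewrite subr_eq0 => /eqP.
  by apply/negP => /(descent_lt uS.1 un.2); lia.
- move=> m' i Ni _ m'i; apply/eqP/negPn/negP; rewrite mcoeff_neq0 => h.
  have im : i \in finsupp m' by rewrite -cmE_neq0 -lt0n.
  by move: Ni; rewrite /N (big_fsetD1 _ h) /= (big_fsetD1 _ im) /=; lia.
Qed.

Lemma mshift_mshift k l m : mshift k (mshift l m) = mshift (k + l) m.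
Proof. by apply: monoP => i; rewrite !mshiftE; congr (m _); lia. Qed.

Lemma mshift_swap k j m : mshift k (mswap j m) = mswap (j + k) (mshift k m).
Proof.
apply: monoP => i; rewrite !(mshiftE, mswapE); congr (m _); simple_refl_lia.
Qed.

Lemma mshift_mdivx k j m : mshift k (mdivx m j) = mdivx (mshift k m) (j + k).
Proof.
apply: monoP => i; rewrite !(mshiftE, mdivxE); congr (_ - nat_of_bool _)%N; lia.
Qed.

Lemma mulx_mshift k j (G : series) m :
  mulx (j + k) G (mshift k m) = mulx j (fun m => G (mshift k m)) m.
Proof. by rewrite /mulx mshiftE addrK mshift_mdivx. Qed.

Lemma shift_perm_id : shift_perm id = id.
Proof. by apply/funext => i; rewrite /shift_perm subrK. Qed.

(** Let D(m) be the difference of the two sides. By induction on the length the divided differences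
    of both polynomials agree, so D is invariant under s_j for j >= 1; it vanishes once a large
    variable occurs, and [pushup] concludes. The monomial 1 is settled by degree. *)
Lemma schubert_shift w m : S_infty w -> (forall k, k <= 0 -> m k = 0%N) ->
  schubert_coef (shift_perm w) (mshift 1 m) = schubert_coef w m.
Proof.
move: {2}(inv_number w) (erefl (inv_number w)) => d.
elim: d w m => [|d IH] w m wd wS m0.
  have [->|/(S_Z_descent wS.1)[i /(inv_number_desc wS.1)]] := pselect (w = id); last by lia.
  rewrite shift_perm_id /schubert_coef schubert_id !mcoeff1; congr (nat_of_bool _)%:R.
  by rewrite -!mdeg_eq0 mdeg_mshift.
have sS : S_infty (shift_perm w) by apply: (iter_shift_perm_infty 1).
have [n wn] := S_infty_fin wS.
have sn := shift_perm_fin wn.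
apply/eqP; rewrite -subr_eq0; apply/eqP.
have [->|m1] := eqVneq m mone.
  apply/eqP; rewrite subr_eq0; apply/eqP; transitivity (0 : rat).
    apply/eqP/negPn/negP => /(schubert_supp sS)[_].
    by rewrite mdeg_mshift mdeg1 inv_number_shift // wd.
  apply/esym/eqP/negPn/negP => /(schubert_supp wS)[_].
  by rewrite mdeg1 wd.
have [i mi] : exists i, (0 < m i)%N.
  apply: contrapT => h; case/eqP: m1; apply: monoP => i; rewrite cm1.
  by have [|mi] := posnP (m i) => //; case: h; exists i.
have i0 : 1 <= i by rewrite leNgt; apply/negP => i0; move: mi; rewrite m0 //; lia.
apply: (@pushup (fun m => schubert_coef (shift_perm w) (mshift 1 m) - schubert_coef w m)
  (fun m => forall k, k <= 0 -> m k = 0%N) 1 n%:Z m i) => //; last first.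
  move=> m' j nj _ m'j; rewrite (schubert_bound wn nj m'j) subr0.
  by apply: (@schubert_bound n.+1 _ _ (j + 1)) => //; [lia|rewrite mshiftE addrK].
move=> {i mi i0 m1 m0 m} {}m j j0 m0; split.
  by move=> k k0; rewrite mswapE (_ : simple_refl j k = k) ?m0 //; simple_refl_lia.
have E1 := schubert_is_divdiff wS (ltac:(lia) : 0 < j) m.
have E2 := schubert_is_divdiff sS (ltac:(lia) : 0 < j + 1) (mshift 1 m).
have key l : mulx (l + 1) (at_descent schubert_coef (shift_perm w) (j + 1)) (mshift 1 m) =
    mulx l (at_descent schubert_coef w j) m.
  rewrite mulx_mshift /mulx; case: ifP => // ml.
  rewrite /at_descent (_ : (shift_perm w (j + 1 + 1) < _) = (w (j + 1) < w j)); last first.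
    by rewrite /shift_perm !addrK ltrD2r.
  case: ifP => // dj; rewrite -shift_perm_comp; apply: IH.
  - by have := inv_number_desc wS.1 dj; rewrite wd => -[].
  - by apply: S_infty_comp => //; lia.
  - by move=> k k0; rewrite mdivxE m0.
rewrite mshift_swap; rewrite !key in E2.
move: E1 E2; lra.
Qed.

(** A shift by this amount makes all indices of m positive. *)
Definition shift_bound (m : mono) : nat := (\sum_(i <- finsupp m) absz i).+1.

Lemma shift_boundP m (M : nat) k : (shift_bound m <= M)%N -> k <= 0 -> mshift M%:Z m k = 0%N.
Proof.
move=> mM k0; rewrite mshiftE; apply/eqP; rewrite cmE_eq0; apply/negP => km.
by move: mM; rewrite /shift_bound (big_fsetD1 _ km) /=; lia.
Qed.

(** The limit in explicit form: each coefficient is read off after a shift from which on it is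
    constant. *)
Definition stable_schubert (w : int -> int) : series := fun m =>
  schubert_coef (iter (shift_bound m) shift_perm w) (mshift (shift_bound m)%:Z m).

Lemma stable_schubertE w m (M : nat) : S_infty w -> (shift_bound m <= M)%N ->
  stable_schubert w m = schubert_coef (iter M shift_perm w) (mshift M%:Z m).
Proof.
move=> wS /subnK <-; elim: (M - _)%N => [|d ->] //; set N := (d + shift_bound m)%N.
rewrite addSn iterS -/N -(@schubert_shift _ (mshift N m)).
- by rewrite mshift_mshift; congr (schubert_coef _ (mshift _ _)); lia.
- exact: iter_shift_perm_infty.
- by move=> k k0; apply: shift_boundP => //; rewrite /N leq_addl.
Qed.

Lemma stable_schubert_deg w m : S_infty w -> stable_schubert w m != 0 ->
  mdeg m = inv_number w.
Proof.
move=> wS /(schubert_supp (iter_shift_perm_infty _ wS))[_].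
by rewrite mdeg_mshift inv_number_iter_shift.
Qed.

Lemma stable_schubert_bound n w m j : S_fin n w -> n%:Z <= j -> (0 < m j)%N ->
  stable_schubert w m = 0.
Proof.
move=> wn nj mj; apply: (@schubert_bound _ _ _ (j + (shift_bound m)%:Z)).
- exact: (iter_shift_perm_fin (shift_bound m) wn).
- by lia.
- by rewrite mshiftE addrK.
Qed.

Lemma stable_schubert_is_divdiff w j : S_infty w ->
  is_divdiff j (stable_schubert w) (at_descent stable_schubert w j).
Proof.
move=> wS m.
(* One shift that suits all monomials of the identity and makes j + M positive. *)
pose M := (shift_bound m + shift_bound (mswap j m) + shift_bound (mdivx m j) +
  shift_bound (mdivx m (j + 1)) + absz j + 1)%N.
have M0 : 0 < j + M%:Z by rewrite /M; lia.
rewrite !(@stable_schubertE _ _ M) //; [|by rewrite /M; lia..].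
have wM := iter_shift_perm_infty M wS.
have := schubert_is_divdiff wM M0 (mshift M%:Z m); rewrite -mshift_swap => ->.
have key l : (shift_bound (mdivx m l) <= M)%N ->
    mulx (l + M%:Z) (at_descent schubert_coef (iter M shift_perm w) (j + M%:Z)) (mshift M%:Z m) =
    mulx l (at_descent stable_schubert w j) m.
  move=> lM; rewrite mulx_mshift /mulx; case: ifP => // ml.
  rewrite /at_descent (_ : (_ < iter M _ _ _) = (w (j + 1) < w j)); last first.
    by rewrite !iter_shift_permE addrK ltrD2r (_ : j + M%:Z + 1 - M%:Z = j + 1) //; lia.
  case: ifP => // dj; rewrite -iter_shift_perm_comp (@stable_schubertE _ _ M) //.
  by apply: S_infty_comp => //; apply: S_infty_descent wS dj.
rewrite key; last by rewrite /M; lia.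
by rewrite (_ : j + M%:Z + 1 = j + 1 + M%:Z) ?key //; rewrite /M; lia.
Qed.

Lemma stable_schubert_id : stable_schubert id mone = 1.
Proof.
rewrite /stable_schubert; have -> n : iter n shift_perm id = id.
  by elim: n => //= n ->; apply: shift_perm_id.
by rewrite /schubert_coef schubert_id mcoeff1 -mdeg_eq0 mdeg_mshift mdeg1.
Qed.

(** All shifts of w lie in [S_infty], so the limit picked by [xget] and the explicit one can be
    compared at a common large shift. *)
Lemma back_schubertE w : S_infty w -> back_schubert w = stable_schubert w.
Proof.
move=> wS; have iS (M : nat) : S_infty (iter M shift_perm w) by apply: iter_shift_perm_infty.
have E (M : nat) (mu : mono) : (shift_bound mu <= M)%N ->
    (rename (fun i => i - M%:Z) (schubert (iter M shift_perm w)))@_mu = stable_schubert w mu.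
  move=> muM; rewrite (stable_schubertE wS muM).
  by apply: (@rename_coef (fun i => i + M%:Z)) => i; rewrite ?addrK ?subrK.
pose lim := [set F : series | forall mu : mono, exists N : nat,
    forall m : nat, (N <= m)%N -> S_infty (iter m shift_perm w) ->
      (rename (fun i => i - m%:Z) (schubert (iter m shift_perm w)))@_mu = F mu].
have : exists F, lim F.
  by exists (stable_schubert w) => mu; exists (shift_bound mu) => M muM _; apply: E.
move=> /(xgetPex (fun=> 0)) h; apply/funext => mu; have [N hN] := h mu.
have := hN (N + shift_bound mu)%N (leq_addr _ _) (iS _).
by rewrite E ?leq_addl // => <-.
Qed.

(** The monomial x_a x_(a-1) ... x_(a-d+1). Without its largest variable it has the same shape, as
    an induction on the length requires. *)
Fixpoint sqfree_mono (a : int) (d : nat) : mono :=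
  if d is d'.+1 then mmul (ucm a) (sqfree_mono (a - 1) d') else mone.

Lemma mdeg_sqfree_mono a d : mdeg (sqfree_mono a d) = d.
Proof. by elim: d a => [|d IH] a /=; rewrite ?mdeg1 // mdegM mdegU IH. Qed.

Lemma sqfree_mono_out (a : int) d i : a < i -> sqfree_mono a d i = 0%N.
Proof.
elim: d a => [|d IH] a ai /=; first by rewrite cm1.
by rewrite cmM cmU IH; [case: eqP; lia|lia].
Qed.

(* Telescoping the coefficients of x_i * nu over i >= a, for nu a squarefree
   monomial in variables smaller than x_a: consecutive differences are the
   coefficients of nu in the divided differences. *)
Lemma stable_schubert_sqfree w (a : int) : S_infty w -> a <= 0 ->
  stable_schubert w (sqfree_mono a (inv_number w)) = (n_reduced_words w)%:R.
Proof.
move: {2}(inv_number w) (erefl (inv_number w)) => d.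
elim: d w a => [|d IH] w a wd wS a0.
  have [->|/(S_Z_descent wS.1)[i /(inv_number_desc wS.1)]] := pselect (w = id); last by lia.
  by rewrite inv_number_id stable_schubert_id n_reduced_words_id.
have wid : w <> id by move=> wid; move: wd; rewrite wid inv_number_id.
have [n wn] := S_infty_fin wS.
rewrite wd; set nu := sqfree_mono (a - 1) d.
have nu0 i : a <= i -> nu i = 0%N by move=> ai; apply: sqfree_mono_out; lia.
(* a + T = n, a point at which [D] vanishes. *)
pose T := absz (n%:Z - a); pose D i := stable_schubert w (mmul (ucm i) nu).
have step i : a <= i -> D i - D (i + 1) =
    (if w (i + 1) < w i then n_reduced_words (w \o simple_refl i) else 0%N)%:R.
  move=> ai; have := stable_schubert_is_divdiff i wS (mmul (ucm i) nu).
  have -> : mswap i (mmul (ucm i) nu) = mmul (ucm (i + 1)) nu.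
    apply: monoP => k; rewrite mswapE !cmM !cmU.
    have [[-> ->]|[[-> ->]|[h1 [h2 ->]]]] := simple_refl_spec i k.
    - by rewrite !nu0; [case: eqP; case: eqP; lia|lia|lia].
    - by rewrite !nu0 ?eqxx; [lia|lia|lia].
    - by congr (nat_of_bool _ + _)%N; lia.
  rewrite -/(D i) -/(D (i + 1)) => ->.
  (* x_(i+1) does not divide x_i nu, so the second term drops out. *)
  rewrite (mulxU i); have -> G : mulx (i + 1) G (mmul (ucm i) nu) = 0.
    have h : mmul (ucm i) nu (i + 1) = 0%N.
      have n0 : nu (i + 1) = 0%N by apply: nu0; lia.
      by rewrite cmM cmU n0; case: eqP => //; lia.
    by rewrite /mulx h.
  rewrite subr0.
  rewrite /at_descent; case: ifP => // di.
  have nd := inv_number_desc wS.1 di; have i0 := S_infty_descent wS di.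
  have ed : inv_number (w \o simple_refl i) = d by lia.
  rewrite -(IH _ (a - 1)) ?ed //; first exact: S_infty_comp.
  by lia.
have tele t : D a - D (a + t%:Z) = \sum_(i <- [seq a + p%:Z | p <- iota 0 t])
    (if w (i + 1) < w i then n_reduced_words (w \o simple_refl i) else 0%N)%:R.
  elim: t => [|t IHt]; first by rewrite addr0 subrr big_nil.
  rewrite -addn1 iotaD map_cat big_cat -IHt /= big_cons big_nil addr0 add0n.
  rewrite -step; last by lia.
  by rewrite (_ : a + t%:Z + 1 = a + (t + 1)%N%:Z); [lra|lia].
have DT : D (a + T%:Z) = 0.
  apply: (@stable_schubert_bound n _ _ (a + T%:Z) wn); first by rewrite /T; lia.
  by rewrite cmM cmUU.
rewrite -[LHS]subr0 -DT tele (@n_reduced_words_rec w [seq a + p%:Z | p <- iota 0 T]) //.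
- by rewrite natr_sum.
- exact: wS.1.
- by rewrite map_inj_uniq ?iota_uniq // => k l /addrI[].
- move=> i di; have i0 := S_infty_descent wS di; have ilt := descent_lt wS.1 wn.2 di.
  apply/mapP; exists (absz (i - a)); last by lia.
  by rewrite mem_iota /T; lia.
Qed.

(** * The span of the elementary products *)

Implicit Types (mu : mono) (f g h F G : series).

(** * The product of formal series *)

Lemma mono_ind (P : mono -> Prop) :
  P mone -> (forall i m, P m -> P (mmul (ucm i) m)) -> forall m, P m.
Proof.
move=> P1 PM m; move: {2}(mdeg m) (erefl (mdeg m)) => d.
elim: d m => [|d IH] m md; first by rewrite (mdeg_eq0I md).
have [i mi] : exists i, (0 < m i)%N.
  apply: contrapT => h; suff E : m = mone by rewrite E mdeg1 in md.
  apply: monoP => i; rewrite cm1.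
  by have [|mi] := posnP (m i) => //; case: h; exists i.
rewrite -(mdivxK mi); apply: PM; apply: IH.
by move: md; rewrite -{1}(mdivxK mi) mdegM mdegU => -[].
Qed.

Lemma mmul_cancel m m1 m2 : mmul m m1 = mmul m m2 -> m1 = m2.
Proof.
move=> E; apply: monoP => i; have := congr1 (fun m : mono => m i) E.
by rewrite /= !cmM => /addnI.
Qed.

Lemma mmul_ucm_split i p q m : mmul p q = mmul (ucm i) m ->
  (exists2 p', p = mmul (ucm i) p' & mmul p' q = m) \/
  (exists2 q', q = mmul (ucm i) q' & mmul p q' = m).
Proof.
move=> E; have Ei := congr1 (fun m : mono => m i) E; rewrite /= !cmM cmUU in Ei.
have [pi|pi] := posnP (p i).
  have qi : (0 < q i)%N by rewrite pi add0n in Ei; rewrite Ei.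
  right; exists (mdivx q i); first by rewrite mdivxK.
  by apply: (@mmul_cancel (ucm i)); rewrite -E mulmA [mmul (ucm i) p]mulmC -mulmA mdivxK.
left; exists (mdivx p i); first by rewrite mdivxK.
by apply: (@mmul_cancel (ucm i)); rewrite -E mulmA mdivxK.
Qed.

(** A finite set of divisors turns the convolution into a double sum; having both factors in the
    same set allows sums to be exchanged. *)
Lemma mono_divisors mu : exists d : {fset mono},
  forall p q, mmul p q = mu -> p \in d /\ q \in d.
Proof.
suff [d dP] : exists d : {fset mono}, forall p q, mmul p q = mu -> p \in d.
  by exists d => p q E; split; [apply: (dP _ q)|apply: (dP _ p); rewrite mulmC].
elim/mono_ind: mu => [|i m [d dP]].
  exists [fset (mone : mono)]%fset => p q E.
  by have [-> _] := unitm _ _ E; rewrite in_fset1 eqxx.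
exists (d `|` [fset mmul (ucm i) p | p in d])%fset => p q /mmul_ucm_split[[p' -> E]|[q' _ E]].
  by rewrite inE; apply/orP; right; apply/imfsetP; exists p' => //=; apply: dP E.
by rewrite inE (dP _ _ E).
Qed.

Lemma series_mulE (d : {fset mono}) f g mu :
  (forall p q, mmul p q = mu -> p \in d /\ q \in d) ->
  series_mul f g mu =
  \sum_(p <- d) \sum_(q <- d) (if mmul p q == mu then f p * g q else 0).
Proof.
move=> dP; pose r := [seq x <- [seq (p, q) | p <- d, q <- d] | mmul x.1 x.2 == mu].
rewrite /series_mul (@fsbigE _ _ _ _ _ r) /=.
- rewrite big_mkcond big_filter big_mkcond big_allpairs; apply: eq_bigr => p _.
  apply: eq_bigr => q _ /=; case: eqP => // E; rewrite ifT //.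
  by rewrite inE.
- rewrite filter_uniq // allpairs_uniq //.
  by move=> [a b] [a' b'] _ _ /=.
- by move=> [p q] /=; rewrite mem_filter => /andP[/eqP].
- move=> [p q] /= E; rewrite mem_filter /= E eqxx /= => /negP; case.
  by apply/allpairsP; exists (p, q); have [] := dP _ _ E.
Qed.

Lemma series_mulC : commutative series_mul.
Proof.
move=> f g; apply/funext => mu; have [d dP] := mono_divisors mu.
rewrite !(series_mulE _ _ dP) exchange_big; apply: eq_bigr => p _.
by apply: eq_bigr => q _; rewrite mulmC mulrC.
Qed.

Lemma series_mul1 : left_id series_one series_mul.
Proof.
move=> f; apply/funext => mu; rewrite /series_mul (@fsbigE _ _ _ _ _ [:: (mone, mu)]) //=.
- by rewrite big_cons big_nil ifT ?inE /= ?mul1m // /series_one eqxx mul1r addr0.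
- by move=> p; rewrite /= inE => /eqP ->; rewrite /= mul1m.
- move=> [p q] /= E; rewrite inE /series_one => n.
  have [pE|pn] := eqVneq p mone; last by rewrite mul0r.
  by move: n; rewrite -E pE mul1m eqxx.
Qed.

Lemma series_mul_mulE (d : {fset mono}) f g h mu :
  (forall p q, mmul p q = mu -> p \in d /\ q \in d) ->
  series_mul (series_mul f g) h mu =
  \sum_(c <- d) \sum_(a <- d) \sum_(b <- d)
    (if mmul (mmul a b) c == mu then f a * g b * h c else 0).
Proof.
move=> dP; rewrite (series_mulE _ _ dP) exchange_big; apply: eq_bigr => c _.
transitivity (\sum_(p <- d) \sum_(a <- d) \sum_(b <- d)
    (if (mmul p c == mu) && (mmul a b == p) then f a * g b * h c else 0)).
  apply: eq_bigr => p _; case: eqP => [E|_]; last by rewrite !big1 // => *; rewrite big1.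
  rewrite (@series_mulE d) => [|a b ab]; last first.
    split; first by apply: (dP a (mmul b c) _).1; rewrite mulmA ab.
    by apply: (dP b (mmul a c) _).1; rewrite mulmA [mmul b a]mulmC ab.
  rewrite big_distrl; apply: eq_bigr => a _; rewrite big_distrl; apply: eq_bigr => b _ /=.
  by case: ifP => _; rewrite ?mul0r.
rewrite exchange_big; apply: eq_bigr => a _; rewrite exchange_big; apply: eq_bigr => b _ /=.
case: eqP => [E|nE].
  have abd : mmul a b \in d by apply: (dP _ c _).1.
  rewrite (big_fsetD1 _ abd) E !eqxx big1_fset => [|p]; first exact: addr0.
  by rewrite in_fsetD1 => /andP[/negbTE pab] _ _; rewrite (eq_sym (mmul a b)) pab andbF.
by rewrite big1 // => p _; case: eqP => //= E; case: eqP => // E'; case: nE; rewrite E'.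
Qed.

(** Either bracketing is the sum over the triples a, b, c with a b c = mu. *)
Lemma series_mulA : associative series_mul.
Proof.
move=> f g h; apply/funext => mu; have [d dP] := mono_divisors mu.
rewrite [series_mul f _]series_mulC !(series_mul_mulE _ _ _ dP).
rewrite [RHS]exchange_big; apply: eq_bigr => a _; rewrite [RHS]exchange_big.
apply: eq_bigr => b _; apply: eq_bigr => c _.
by rewrite [mmul (mmul b c) a]mulmC mulmA [_ * f a]mulrC mulrA.
Qed.

HB.instance Definition _ := Monoid.isComLaw.Build ({cmonom int} -> rat) series_one
  series_mul series_mulA series_mulC series_mul1.

Lemma series_mulDr f g h mu :
  series_mul f (fun m => g m + h m) mu = series_mul f g mu + series_mul f h mu.
Proof.
have [d dP] := mono_divisors mu; rewrite !(series_mulE _ _ dP) -big_split.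
apply: eq_bigr => p _; rewrite -big_split; apply: eq_bigr => q _ /=.
by case: ifP; rewrite ?mulrDr ?addr0.
Qed.

Lemma series_mulZr (c : rat) f g mu :
  series_mul f (fun m => c * g m) mu = c * series_mul f g mu.
Proof.
have [d dP] := mono_divisors mu; rewrite !(series_mulE _ _ dP) big_distrr.
apply: eq_bigr => p _; rewrite big_distrr; apply: eq_bigr => q _ /=.
by case: ifP; rewrite ?mulr0 // mulrCA.
Qed.

Lemma series_mul_sumr (I : Type) (s : seq I) (c : I -> rat) f (G : I -> series) mu :
  series_mul f (fun m => \sum_(x <- s) c x * G x m) mu =
  \sum_(x <- s) c x * series_mul f (G x) mu.
Proof.
elim: s => [|x s IH].
  rewrite big_nil; have [d dP] := mono_divisors mu; rewrite (series_mulE _ _ dP).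
  by rewrite big1 // => p _; rewrite big1 // => q _; rewrite big_nil mulr0 if_same.
rewrite big_cons -IH -series_mulZr -series_mulDr; congr (series_mul f _ mu).
by apply/funext => m; rewrite big_cons.
Qed.

Definition series_var (i : int) : series := fun m => (m == ucm i)%:R.

Lemma series_var_mul i g : series_mul (series_var i) g = mulx i g.
Proof.
apply/funext => mu; rewrite /mulx /series_mul; case: ifP => mi.
  rewrite (@fsbigE _ _ _ _ _ [:: (ucm i, mdivx mu i)]) //=.
  - rewrite big_cons big_nil ifT ?inE /=; last exact: mdivxK.
    by rewrite /series_var eqxx mul1r addr0.
  - by move=> p; rewrite /= inE => /eqP ->; rewrite /= mdivxK.
  - move=> [p q] /= E; rewrite inE /series_var => n.
    have [pE|pn] := eqVneq p (ucm i); last by rewrite mul0r.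
    by move: n; rewrite -E pE mulxK eqxx.
rewrite fsbig1 // => -[p q] /= E; rewrite /series_var.
have [pE|pn] := eqVneq p (ucm i); last by rewrite mul0r.
by move: mi; rewrite -E pE cmM cmUU.
Qed.

Lemma series_mul_mulx i f g : series_mul f (mulx i g) = mulx i (series_mul f g).
Proof. by rewrite -!series_var_mul series_mulA (series_mulC f) -series_mulA. Qed.

(** * Elementary series and their straightening *)

Definition sqfree_le (k : int) (m : mono) : bool :=
  all (fun i => (m i == 1%N) && (i <= k)) (finsupp m).

Lemma sqfree_leP k m : reflect (forall i, m i <= (i <= k)%R)%N (sqfree_le k m).
Proof.
apply: (iffP allP) => h i.
  have [/h/andP[/eqP -> ->] //|im] := boolP (i \in finsupp m).
  by move: im; rewrite -cmE_eq0 => /eqP ->.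
rewrite -cmE_neq0; have := h i; case: (i <= k); case: (m i) => [|[|n]] //.
Qed.

Lemma back_elemE d k m : back_elem d k m = ((mdeg m == d) && sqfree_le k m)%:R.
Proof. by []. Qed.

Lemma back_elem0 k : back_elem 0 k = series_one.
Proof.
apply/funext => m; rewrite back_elemE mdeg_eq0 /series_one.
case: eqP => //= ->; rewrite (_ : sqfree_le _ _ = true) //.
by apply/sqfree_leP => i; rewrite cm1.
Qed.

(** A squarefree monomial in the x_i with i <= k + 1 either avoids x_(k+1) or contains it exactly
    once. *)
Lemma back_elemS d k m :
  back_elem d.+1 (k + 1) m = back_elem d.+1 k m + mulx (k + 1) (back_elem d k) m.
Proof.
have kk : (k + 1 <= k) = false by lia.
rewrite /mulx; case: ifP => mk; rewrite !back_elemE.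
  have -> : sqfree_le k m = false.
    by apply/negP => /sqfree_leP/(_ (k + 1)); rewrite kk leqn0 => /eqP E; rewrite E in mk.
  rewrite andbF add0r; congr (nat_of_bool _)%:R.
  rewrite -{1}(mdivxK mk) mdegM mdegU eqSS; congr (_ && _).
  apply/sqfree_leP/sqfree_leP => h i; have := h i; rewrite mdivxE.
    have [<-|ik] := eqVneq (k + 1) i; first by rewrite kk lexx leqn0 subn_eq0.
    by rewrite subn0 (_ : (i <= k + 1) = (i <= k)) //; lia.
  have [<-|ik] := eqVneq (k + 1) i; first by rewrite kk lexx leqn0 subn_eq0.
  by rewrite subn0 (_ : (i <= k + 1) = (i <= k)) //; lia.
rewrite addr0; congr (nat_of_bool _)%:R; congr (_ && _).
apply/sqfree_leP/sqfree_leP => h i; have := h i.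
  have [<-|ik] := eqVneq (k + 1) i; first by move: mk; case: (m _).
  by rewrite (_ : (i <= k + 1) = (i <= k)) //; lia.
have [<-|ik] := eqVneq (k + 1) i; first by move: mk; case: (m _).
by rewrite (_ : (i <= k + 1) = (i <= k)) //; lia.
Qed.

(** Expanding the alphabet k + 1 by [back_elemS], the two terms with x_(k+1) are both x_(k+1) e_p
    e_q and cancel. *)
Lemma back_elem_straighten p q k mu :
  series_mul (back_elem p k) (back_elem q.+1 k) mu =
  series_mul (back_elem p k) (back_elem q.+1 (k + 1)) mu -
  series_mul (back_elem q k) (back_elem p.+1 (k + 1)) mu +
  series_mul (back_elem p.+1 k) (back_elem q k) mu.
Proof.
have E d : back_elem d.+1 (k + 1) =
    (fun m => back_elem d.+1 k m + mulx (k + 1) (back_elem d k) m).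
  by apply/funext => m; apply: back_elemS.
rewrite !E !series_mulDr !series_mul_mulx (series_mulC (back_elem p.+1 k)).
by rewrite (series_mulC (back_elem q k) (back_elem p k)); lra.
Qed.

Lemma back_e_insert k p (a : mono) : a k = 0%N ->
  back_e (mmul (monX k p) a) = series_mul (back_elem p k) (back_e a).
Proof.
move=> ak; have aE i : mmul (monX k p) a i = if k == i then p else a i.
  by rewrite (cmM i (monX k p)) monXE; case: eqP => [<-|_]; rewrite ?ak ?addn0 ?mul1n.
case: p aE => [|p] aE; first by rewrite back_elem0 series_mul1 /monX /= mul1m.
have kin : k \in finsupp (mmul (monX k p.+1) a) by rewrite -cmE_neq0 aE eqxx.
rewrite /back_e (big_fsetD1 _ kin) aE eqxx; congr series_mul.
have -> : (finsupp (mmul (monX k p.+1) a) `\ k)%fset = finsupp a.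
  apply/fsetP => i; rewrite in_fsetD1 -!cmE_neq0 aE eq_sym.
  by case: eqP => [<-|] //=; rewrite ak.
apply: eq_big_seq => i; rewrite -cmE_neq0 aE; have [<-|//] := eqVneq k i.
by rewrite ak eqxx.
Qed.

(** A list may repeat an index, which makes addition a concatenation. The predicate P serves the
    induction in [spanned_elem_mul], where exponents below k have to stay unchanged. *)
Definition spanned (P : mono -> Prop) (F : series) := exists s : seq (rat * mono),
  (forall p, p \in s -> P p.2) /\
  forall mu, F mu = \sum_(p <- s) p.1 * back_e p.2 mu.

Lemma spanned_e (P : mono -> Prop) a : P a -> spanned P (back_e a).
Proof.
move=> Pa; exists [:: (1, a)]; split; first by move=> p; rewrite inE => /eqP ->.
by move=> mu; rewrite big_seq1 mul1r.
Qed.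

Lemma spanned_ext P F G : F =1 G -> spanned P F -> spanned P G.
Proof. by move=> /funext ->. Qed.

Lemma spannedS (P Q : mono -> Prop) F : (forall a, P a -> Q a) -> spanned P F -> spanned Q F.
Proof. by move=> PQ [s [sP sE]]; exists s; split => // p /sP/PQ. Qed.

Lemma spanned0 P : spanned P (fun=> 0).
Proof. by exists [::]; split => // mu; rewrite big_nil. Qed.

Lemma spannedD P F G : spanned P F -> spanned P G -> spanned P (fun m => F m + G m).
Proof.
move=> [s [sP sE]] [t [tP tE]]; exists (s ++ t); split.
  by move=> p; rewrite mem_cat => /orP[/sP|/tP].
by move=> mu; rewrite big_cat sE tE.
Qed.

Lemma spannedZ P (c : rat) F : spanned P F -> spanned P (fun m => c * F m).
Proof.
move=> [s [sP sE]]; exists [seq (c * p.1, p.2) | p <- s]; split.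
  by move=> p /mapP[q /sP qP ->].
by move=> mu; rewrite sE big_distrr big_map; apply: eq_bigr => p _ /=; rewrite mulrA.
Qed.

Lemma spannedB P F G : spanned P F -> spanned P G -> spanned P (fun m => F m - G m).
Proof.
move=> PF /(spannedZ (-1)) PG; apply: spanned_ext (spannedD PF PG) => m.
by rewrite mulN1r.
Qed.

Lemma spanned_sum P (I : Type) (s : seq I) (c : I -> rat) (G : I -> series) :
  (forall x, spanned P (G x)) -> spanned P (fun m => \sum_(x <- s) c x * G x m).
Proof.
move=> GP; elim: s => [|x s IH].
  by apply: spanned_ext (spanned0 P) => m; rewrite big_nil.
apply: spanned_ext (spannedD (spannedZ (c x) (GP x)) IH) => m.
by rewrite big_cons.
Qed.

Lemma spanned_mul (P Q : mono -> Prop) F G :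
  (forall a, P a -> spanned Q (series_mul G (back_e a))) ->
  spanned P F -> spanned Q (series_mul G F).
Proof.
move=> PQ [s [sP sE]].
have {sE} -> : F = (fun m => \sum_(p <- s) p.1 * back_e p.2 m) by apply/funext.
apply: (@spanned_ext _ (fun m => \sum_(p <- s) p.1 * series_mul G (back_e p.2) m)).
  by move=> m; rewrite series_mul_sumr.
elim: s sP => [|x s IH] sP.
  by apply: spanned_ext (spanned0 Q) => m; rewrite big_nil.
have sPx := PQ _ (sP x (mem_head _ _)).
have {}IH : spanned Q (fun m => \sum_(p <- s) p.1 * series_mul G (back_e p.2) m).
  by apply: IH => p ps; apply: sP; rewrite inE ps orbT.
apply: spanned_ext (spannedD (spannedZ x.1 sPx) IH) => m.
by rewrite big_cons.
Qed.

(* Straightening e_p e_q in the same alphabet moves the excess to the next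
   larger alphabet, until it lies beyond the support of a. *)
Lemma spanned_elem_mul (a : mono) k p :
  (* The exponents below k are kept under control because the induction passes from k to k + 1 and
     then needs the exponent at k to be still free. *)
  spanned (fun b => forall i, i < k -> b i = a i) (series_mul (back_elem p k) (back_e a)).
Proof.
have [t at0] : exists t : nat, forall i, k + t%:Z <= i -> a i = 0%N.
  exists (\sum_(i <- finsupp a) absz i + absz k).+1%N => i ki.
  apply/eqP; rewrite cmE_eq0; apply/negP => ia; move: ki.
  by rewrite (big_fsetD1 _ ia) /=; lia.
elim: t a k p at0 => [|t IH] a k p at0.
  have ak : a k = 0%N by apply: at0; lia.
  rewrite -(back_e_insert p ak); apply: spanned_e => i ik.
  by rewrite (cmM i (monX k p)) monXE (_ : (k == i) = false) //; lia.
pose a' := [cmonom a i | i in (finsupp a `\ k)%fset]%M.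
have a'E i : a' i = if i == k then 0%N else a i.
  rewrite cmE fsfun_fun in_fsetD1; case: eqP => //= _.
  by case: ifP => // /negbT; rewrite -cmE_eq0 => /eqP.
have a'k : a' k = 0%N by rewrite a'E eqxx.
have -> : a = mmul (monX k (a k)) a'.
  apply: monoP => i; rewrite (cmM i (monX k (a k))) monXE a'E eq_sym.
  by case: eqP => [->|]; rewrite ?mul1n ?addn0.
rewrite (back_e_insert _ a'k).
apply: (@spannedS (fun b => forall i, i < k -> b i = a' i)).
  move=> b bE i ik; rewrite bE // (cmM i (monX k (a k))) monXE (_ : (k == i) = false) //.
  by lia.
move: (a k) => q.
(* The factor of alphabet k + 1 is absorbed by induction, which leaves the exponent at k equal to
   zero; the factor e_r of alphabet k then fills it. *)
have T r s : spanned (fun b => forall i, i < k -> b i = a' i)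
    (series_mul (back_elem r k) (series_mul (back_elem s (k + 1)) (back_e a'))).
  apply: (@spanned_mul (fun b => forall i, i < k + 1 -> b i = a' i)); last first.
    by apply: IH => i ik; rewrite a'E at0 ?if_same //; lia.
  move=> b bE; have bk : b k = 0%N by rewrite bE //; lia.
  rewrite -(back_e_insert r bk); apply: spanned_e => i ik.
  by rewrite (cmM i (monX k r)) monXE (_ : (k == i) = false) ?bE //; lia.
(* Straightening trades e_p e_(q+1) for two products covered by [T] and for e_(p+1) e_q, whose
   second degree is smaller. *)
elim: q p => [|q IHq] p.
  by have := T p 0%N; rewrite !back_elem0.
apply: spanned_ext (spannedD (spannedB (T p q.+1) (T q p.+1)) (IHq p.+1)) => mu.
rewrite !series_mulA !(series_mulC _ (back_e a')).
have -> : series_mul (back_elem p k) (back_elem q.+1 k) = (fun mu =>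
  series_mul (back_elem p k) (back_elem q.+1 (k + 1)) mu +
  ((-1) * series_mul (back_elem q k) (back_elem p.+1 (k + 1)) mu +
  series_mul (back_elem p.+1 k) (back_elem q k) mu)).
  by apply/funext => m; rewrite back_elem_straighten; lra.
rewrite !series_mulDr (series_mulZr (-1)); lra.
Qed.

Definition in_span : series -> Prop := spanned (fun=> True).

Lemma in_span_elem_mul F k p : in_span F -> in_span (series_mul (back_elem p k) F).
Proof.
by apply: spanned_mul => a _; apply: spannedS (spanned_elem_mul a k p).
Qed.

Lemma in_span_one : in_span series_one.
Proof.
apply: (@spanned_ext _ (back_e mone)); last exact: spanned_e.
by move=> m; rewrite /back_e mdom1 big_seq_fset0.
Qed.

(** x_i is the difference e_1(..., x_i) - e_1(..., x_(i-1)). *)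
Lemma in_span_mulx F i : in_span F -> in_span (mulx i F).
Proof.
move=> FE; have := spannedB (in_span_elem_mul (i - 1 + 1) 1 FE) (in_span_elem_mul (i - 1) 1 FE).
apply: spanned_ext => mu.
have -> : back_elem 1 (i - 1 + 1) =
    (fun m => back_elem 1 (i - 1) m + mulx (i - 1 + 1) series_one m).
  by apply/funext => m; rewrite back_elemS back_elem0.
rewrite !(series_mulC _ F) series_mulDr series_mul_mulx.
rewrite (series_mulC F series_one) series_mul1 subrK.
lra.
Qed.

(** * Squarefree coefficients *)

Lemma eq_series_mul f f' g g' mu :
  (forall p q, mmul p q = mu -> f p = f' p /\ g q = g' q) ->
  series_mul f g mu = series_mul f' g' mu.
Proof.
move=> H; rewrite /series_mul; apply: eq_fsbigr => -[p q]; rewrite inE /= => /H[-> ->] //.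
Qed.

(** Equality up to monomials divisible by some x_i^2 or by some x_i with i > K. The other monomials
    are closed under divisors, which makes the relation compatible with products. *)
Definition sqfree_eq (K : int) f g : Prop := forall m, sqfree_le K m -> f m = g m.

Lemma sqfree_le_mul K p q : sqfree_le K (mmul p q) -> sqfree_le K p /\ sqfree_le K q.
Proof.
move=> /sqfree_leP h; split; apply/sqfree_leP => i; apply: leq_trans (h i); rewrite cmM.
  exact: leq_addr.
exact: leq_addl.
Qed.

Lemma sqfree_eq_mul K f f' g g' : sqfree_eq K f f' -> sqfree_eq K g g' ->
  sqfree_eq K (series_mul f g) (series_mul f' g').
Proof.
move=> ff gg m mK; apply: eq_series_mul => p q E; rewrite -E in mK.
by have [pK qK] := sqfree_le_mul mK; split; [apply: ff|apply: gg].
Qed.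

Lemma mdeg1_ucm m : mdeg m = 1%N -> exists i, m = ucm i.
Proof.
elim/mono_ind: m => [|i m _]; first by rewrite mdeg1.
by rewrite mdegM mdegU => -[/mdeg_eq0I ->]; exists i; rewrite mulm1.
Qed.

Lemma ucm_inj i j : ucm i = ucm j -> i = j.
Proof.
by move=> /(congr1 (fun m : mono => m i)); rewrite cmUU cmU; case: eqP.
Qed.

Lemma series_var_ucm i j : series_var i (ucm j) = (i == j)%:R.
Proof.
rewrite /series_var; case: (i =P j) => [->|ij]; first by rewrite eqxx.
by case: eqP => // /ucm_inj ji; case: ij.
Qed.

Lemma mdeg_sqfree K m : sqfree_le K m -> mdeg m = #|` finsupp m|.
Proof.
move=> /allP h; rewrite /mdeg -sum1_size big_seq [RHS]big_seq.
by apply: eq_bigr => i /h/andP[/eqP].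
Qed.

(** Any of the n + 1 variables of a squarefree monomial of degree n + 1 can be the one contributed
    by e_1. *)
Lemma sqfree_elem1_mul K n : sqfree_eq K (series_mul (back_elem n K) (back_elem 1 K))
  (fun m => n.+1%:R * back_elem n.+1 K m).
Proof.
move=> m mK; have mP := elimT (sqfree_leP _ _) mK.
(* On divisors of m, the infinite sum e_1 reduces to the sum of the variables of m. *)
transitivity (series_mul (back_elem n K)
    (fun q => \sum_(i <- finsupp m) 1 * series_var i q) m).
  apply: eq_series_mul => p q E; split => //; rewrite back_elemE.
  have [_ ->] : sqfree_le K p /\ sqfree_le K q by apply: sqfree_le_mul; rewrite E.
  rewrite andbT; case: eqP => [/mdeg1_ucm[j qE]|dq].
    have jm : j \in finsupp m by rewrite -cmE_neq0 -E qE cmM cmUU addn1.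
    rewrite [RHS](eq_bigr (fun i => (i == j)%:R)); last first.
      by move=> i _; rewrite mul1r qE series_var_ucm.
    rewrite (big_fsetD1 _ jm) eqxx big1_fset => [|i]; first by rewrite [RHS]addr0.
    by rewrite in_fsetD1 => /andP[/negbTE -> _].
  rewrite big1 => [|i _]; first by [].
  rewrite mul1r /series_var; case: (q =P ucm i) => [qE|]; last by [].
  by case: dq; rewrite qE mdegU.
rewrite series_mul_sumr big_seq.
transitivity (\sum_(i <- finsupp m | i \in finsupp m) back_elem n.+1 K m).
  apply: eq_bigr => i im; rewrite mul1r series_mulC series_var_mul /mulx.
  have mi : (0 < m i)%N by rewrite lt0n cmE_neq0.
  have dm : mdeg m = (mdeg (mdivx m i)).+1 by rewrite -{1}(mdivxK mi) mdegM mdegU.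
  rewrite mi !back_elemE mK dm eqSS.
  rewrite (_ : sqfree_le K (mdivx m i)) //; apply/sqfree_leP => j.
  by rewrite mdivxE; apply: leq_trans (leq_subr _ _) _.
rewrite -big_seq big_const_seq count_predT iter_addr_0 -(mdeg_sqfree mK) !back_elemE mK andbT.
case: eqP => [->|_]; last by rewrite mul0rn mulr0.
by rewrite mulr1.
Qed.

Definition elem1_pow (K : int) (n : nat) : series :=
  iter n (series_mul (back_elem 1 K)) series_one.

Lemma elem1_powD K n p :
  elem1_pow K (n + p) = series_mul (elem1_pow K n) (elem1_pow K p).
Proof.
have S d : elem1_pow K d.+1 = series_mul (back_elem 1 K) (elem1_pow K d) by [].
elim: n => [|n IH]; first by rewrite add0n [elem1_pow K 0]/elem1_pow series_mul1.
by rewrite addSn !S IH series_mulA.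
Qed.

Lemma sqfree_elem1_pow K n :
  sqfree_eq K (elem1_pow K n) (fun m => n`!%:R * back_elem n K m).
Proof.
elim: n => [|n IH] m mK; first by rewrite back_elem0 mul1r.
rewrite [elem1_pow K n.+1]/elem1_pow iterS -/(elem1_pow K n).
rewrite (@sqfree_eq_mul K _ (back_elem 1 K) _ _ (fun _ _ => erefl) IH m mK).
rewrite series_mulZr series_mulC (sqfree_elem1_mul _ mK) factS natrM.
by rewrite mulrA [n`!%:R * _]mulrC.
Qed.

(** On squarefree monomials in the x_j with j <= K all the alphabets coincide and a_i! e_(a_i) is
    e_1^(a_i); the product is e_1^|a|, that is |a|! e_|a|. *)
Lemma back_e_sqfree K (a : mono) : (forall i, i \in finsupp a -> K <= i) ->
  sqfree_eq K (fun m => (\prod_(i <- finsupp a) (a i)`!)%N%:R * back_e a m)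
    (fun m => (mdeg a)`!%:R * back_elem (mdeg a) K m).
Proof.
move=> aK m mK; rewrite -(sqfree_elem1_pow _ mK) /mdeg /back_e.
have {}aK : forall i, i \in (finsupp a : seq int) -> K <= i by [].
elim: (enum_fset (finsupp a)) aK m mK => [|i s IH] aK m mK.
  by rewrite !big_nil mul1r.
rewrite !big_cons elem1_powD natrM -mulrA -series_mulZr.
rewrite (series_mulC (back_elem (a i) i)) -series_mulZr series_mulC.
apply: (sqfree_eq_mul _ _ mK) => {}m {}mK.
  rewrite (sqfree_elem1_pow _ mK) !back_elemE mK (_ : sqfree_le i m) //.
  apply/sqfree_leP => j; apply: leq_trans (elimT (sqfree_leP _ _) mK j) _.
  by have := aK i (mem_head _ _); case: (boolP (j <= K)) => // jK Ki; rewrite (le_trans jK Ki).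
by apply: IH => // j js; apply: aK; rewrite inE js orbT.
Qed.

Lemma sqfree_mono_le a d : sqfree_le a (sqfree_mono a d).
Proof.
apply/sqfree_leP; elim: d a => [|d IH] a i /=; first by rewrite cm1.
rewrite cmM cmU; have := IH (a - 1) i; have := @sqfree_mono_out (a - 1) d i.
have [<-|ai] := eqVneq a i; first by move=> ->; rewrite ?lexx //; lia.
by move=> _ /leq_trans; apply; case: (boolP (i <= a - 1)) => // h; rewrite (_ : i <= a) //; lia.
Qed.

Lemma back_e_sqfree_mono K d (a : mono) : (forall i, i \in finsupp a -> K <= i) ->
  back_e a (sqfree_mono K d) = if d == mdeg a then multinomial a else 0.
Proof.
move=> aK; have := back_e_sqfree aK (sqfree_mono_le K d).
rewrite back_elemE mdeg_sqfree_mono sqfree_mono_le andbT /multinomial.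
have : (\prod_(i <- finsupp a) (a i)`!)%N%:R != 0 :> rat.
  by rewrite pnatr_eq0 -lt0n prodn_gt0 // => i; apply: fact_gt0.
set x := _%:R; case: (d =P mdeg a) => _ x0 E.
  by rewrite -[LHS](mulKf x0) E mulr1 mulrC.
by rewrite -[LHS](mulKf x0) E !mulr0.
Qed.

Lemma sum_multinomial (k : {fsfun mono -> rat with 0}) w : S_infty w ->
  (forall mu, stable_schubert w mu = \sum_(a <- finsupp k) k a * back_e a mu) ->
  \sum_(a <- finsupp k) k a * multinomial a = (n_reduced_words w)%:R.
Proof.
move=> wS kE.
(* No index of the expansion lies below -N, and D exceeds all degrees and the length of w. Summing
   over d < D collects each a at d = |a| and the series at d = l(w). *)
pose N := (\sum_(a <- finsupp k) \sum_(i <- finsupp a) absz i)%N.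
pose D := (\sum_(a <- finsupp k) mdeg a + inv_number w).+1%N.
have aK a : a \in finsupp k -> forall i, i \in finsupp a -> - N%:Z <= i.
  move=> ak i ia; rewrite /N (big_fsetD1 _ ak) /= (big_fsetD1 _ ia) /=; lia.
transitivity (\sum_(d < D) stable_schubert w (sqfree_mono (- N%:Z) d)); last first.
  have iD : (inv_number w < D)%N by rewrite /D; lia.
  rewrite (bigD1 (Ordinal iD)) //= stable_schubert_sqfree //; last by lia.
  rewrite big1 ?addr0 // => d /eqP dw; apply/eqP/negPn/negP.
  move=> /(stable_schubert_deg wS); rewrite mdeg_sqfree_mono => E.
  by apply: dw; apply/val_inj.
under [RHS]eq_bigr do rewrite kE.
rewrite exchange_big big_seq [RHS]big_seq; apply: eq_bigr => a ak.
have dD : (mdeg a < D)%N by rewrite /D (big_fsetD1 _ ak) /=; lia.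
rewrite (bigD1 (Ordinal dD)) //= (back_e_sqfree_mono _ (aK a ak)) eqxx big1 ?addr0 // => d /eqP da.
rewrite (back_e_sqfree_mono _ (aK a ak)); case: eqP => [E|]; last by rewrite mulr0.
by case: da; apply/val_inj.
Qed.

(** * Symmetric series *)

(** An entry is carried to the front by adjacent swaps, and the rest is treated by induction. This
    upgrades invariance under the s_i to invariance under all rearrangements. *)
Lemma adjacent_swap_perm (T : eqType) (U : Type) (f : seq T -> U) :
  (forall s1 s2 x y, f (s1 ++ [:: x, y & s2]) = f (s1 ++ [:: y, x & s2])) ->
  forall s t, perm_eq s t -> f s = f t.
Proof.
move=> sw; have front x s1 s2 s3 : f (s1 ++ s2 ++ x :: s3) = f (s1 ++ x :: s2 ++ s3).
  elim: s2 s1 => [|y s2 IH] s1 //=.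
  by have := IH (rcons s1 y); rewrite !cat_rcons sw.
suff H s t p : perm_eq s t -> f (p ++ s) = f (p ++ t) by move=> s t; apply: (H s t [::]).
elim: s t p => [|x s IH] t p; first by rewrite perm_sym => /perm_nilP ->.
move=> st; have xt : x \in t by rewrite -(perm_mem st) mem_head.
case/splitPr: xt st => t1 t2; rewrite perm_sym perm_catC /= perm_cons perm_catC perm_sym => st.
by rewrite front -!cat_rcons; apply: IH.
Qed.

(** Exponents are listed downwards from x_k, so that exchanging neighbouring entries is the action
    of some s_i with i + 1 <= k. *)
Fixpoint mono_of_seq (k : int) (t : seq nat) : mono :=
  if t is x :: t' then mmul (monX k x) (mono_of_seq (k - 1) t') else mone.

Lemma mono_of_seqE k t i :
  mono_of_seq k t i = if i <= k then nth 0%N t (absz (k - i)%R) else 0%N.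
Proof.
elim: t k => [|x t IH] k /=; first by rewrite cm1 nth_nil if_same.
rewrite (cmM i (monX k x)) monXE IH; have [<-|ki] := eqVneq k i.
  by rewrite lexx subrr /= (_ : (k <= k - 1) = false) ?addn0 ?mul1n //; lia.
rewrite mul0n add0n; have [ik|ik] := boolP (i <= k - 1).
  rewrite (_ : (i <= k) = true); last by lia.
  by rewrite (_ : absz (k - i)%R = (absz (k - 1 - i)%R).+1) //; lia.
by case: ifP => //; lia.
Qed.

Lemma mono_of_seq_swap k s1 s2 x y :
  mswap (k - (size s1)%:Z - 1) (mono_of_seq k (s1 ++ [:: x, y & s2])) =
  mono_of_seq k (s1 ++ [:: y, x & s2]).
Proof.
set j := k - (size s1)%:Z - 1; apply: monoP => i; rewrite mswapE !mono_of_seqE !nth_cat.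
have [[-> ->]|[[-> ->]|[h1 [h2 ->]]]] := simple_refl_spec j i.
- rewrite (_ : absz (k - (j + 1))%R = size s1) /j; last by lia.
  rewrite (_ : absz (k - (k - (size s1)%:Z - 1))%R = (size s1).+1); last by lia.
  rewrite ltnn subnn ltnNge leqnSn /= subSn // subnn /=.
  by rewrite !ifT //; lia.
- rewrite (_ : absz (k - (j + 1))%R = size s1) /j; last by lia.
  rewrite (_ : absz (k - (k - (size s1)%:Z - 1))%R = (size s1).+1); last by lia.
  rewrite ltnn subnn ltnNge leqnSn /= subSn // subnn /=.
  by rewrite !ifT //; lia.
case: ifP => // ik; case: ifP => // hs.
have [p pE] : exists p, absz (k - i)%R = (size s1 + p.+2)%N.
  by exists (absz (k - i)%R - size s1 - 2)%N; rewrite /j in h1 h2; lia.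
by rewrite pE addKn.
Qed.

Lemma mono_of_seq_nseq k t n : mono_of_seq k (t ++ nseq n 0%N) = mono_of_seq k t.
Proof.
apply: monoP => i; rewrite !mono_of_seqE; case: ifP => // _; rewrite nth_cat nth_nseq if_same.
by case: ltnP => // /(nth_default 0%N) ->.
Qed.

Lemma mono_of_seq_exists k m : (forall i, k < i -> m i = 0%N) ->
  exists t, m = mono_of_seq k t.
Proof.
move=> mk; pose L := (\sum_(i <- finsupp m) absz i + absz k).+1.
exists (mkseq (fun p => m (k - p%:Z)) L); apply: monoP => i; rewrite mono_of_seqE.
case: ifP => ik; last by rewrite mk //; lia.
have [h|h] := ltnP (absz (k - i)%R) L.
  by rewrite nth_mkseq //; congr (m _); lia.
rewrite nth_default ?size_mkseq //; apply/eqP; rewrite cmE_eq0; apply/negP => im.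
by move: h; rewrite /L (big_fsetD1 _ im) /=; lia.
Qed.

Definition sym_below (k : int) F : Prop := forall m i, i + 1 <= k -> F (mswap i m) = F m.

Definition bounded_by (k : int) F : Prop := forall m i, k < i -> (0 < m i)%N -> F m = 0.

Definition homog (d : nat) F : Prop := forall m, F m != 0 -> mdeg m = d.

Lemma sym_below_perm k F s t : sym_below k F -> perm_eq s t ->
  F (mono_of_seq k s) = F (mono_of_seq k t).
Proof.
move=> Fs; apply: (adjacent_swap_perm (f := fun s => F (mono_of_seq k s))).
by move=> s1 s2 x y; rewrite -mono_of_seq_swap Fs //; lia.
Qed.

(** The exponent partition of m, unsorted and compared up to [perm_eq]. *)
Definition parts (m : mono) : seq nat := [seq m i | i <- finsupp m].

Lemma perm_filter_nonzero (s : seq nat) :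
  perm_eq s ([seq x <- s | (0 < x)%N] ++ nseq (count (fun x => x == 0%N) s) 0%N).
Proof.
rewrite (_ : nseq _ _ = [seq x <- s | predC (fun x => 0 < x)%N x]).
  by rewrite perm_sym perm_filterC.
by elim: s => // -[|x] s /= <-.
Qed.

Lemma perm_parts_window m (r : seq int) : uniq r -> (forall i, i \in finsupp m -> i \in r) ->
  perm_eq (parts m) [seq x <- [seq m i | i <- r] | (0 < x)%N].
Proof.
move=> ur mr; rewrite filter_map; apply: perm_map.
apply: uniq_perm; [exact: fset_uniq|exact: filter_uniq|].
move=> i; rewrite mem_filter /= lt0n cmE_neq0.
by have [/mr ->|] := boolP (i \in finsupp m).
Qed.

Lemma mkseq_nth_map k t : [seq mono_of_seq k t i | i <- [seq k - p%:Z | p <- iota 0 (size t)]] = t.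
Proof.
apply: (@eq_from_nth _ 0%N); rewrite !size_map size_iota // => p pt.
rewrite (nth_map k) ?size_map ?size_iota // (nth_map 0%N) ?size_iota //.
rewrite nth_iota // add0n mono_of_seqE ifT; last by lia.
by congr (nth _ _ _); lia.
Qed.

Lemma perm_parts_mono_of_seq k t :
  perm_eq (parts (mono_of_seq k t)) [seq x <- t | (0 < x)%N].
Proof.
rewrite -{2}(mkseq_nth_map k t); apply: perm_parts_window.
  by rewrite map_inj_uniq ?iota_uniq // => p q; lia.
move=> i; rewrite -cmE_neq0 mono_of_seqE; case: ifP => // ik nz.
apply/mapP; exists (absz (k - i)%R); last by lia.
rewrite mem_iota /= add0n ltnNge; apply/negP => h; move: nz.
by rewrite nth_default.
Qed.

(** Once the zeros are moved to the end, where they do not affect the monomial, the remaining lists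
    of parts are permutations of each other. *)
Lemma sym_below_parts k F m t : sym_below k F -> (forall i, k < i -> m i = 0%N) ->
  perm_eq (parts m) [seq x <- t | (0 < x)%N] -> F m = F (mono_of_seq k t).
Proof.
move=> Fs /mono_of_seq_exists[s mE]; rewrite mE => pst.
rewrite (sym_below_perm Fs (perm_filter_nonzero s)) (sym_below_perm Fs (perm_filter_nonzero t)).
rewrite !mono_of_seq_nseq; apply: sym_below_perm => //.
by apply: perm_trans pst; rewrite perm_sym; apply: perm_parts_mono_of_seq.
Qed.

Lemma parts_mswap i m : perm_eq (parts (mswap i m)) (parts m).
Proof.
rewrite /parts /mswap finsupp_mact; [|exact: simple_reflK|exact: simple_reflK].
rewrite -/(mswap i m); apply: (@perm_trans _
  [seq mswap i m l | l <- [seq simple_refl i j | j <- finsupp m]]).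
  apply: perm_map; apply: uniq_perm; first exact: fset_uniq.
    by rewrite map_inj_uniq ?fset_uniq //; apply: inv_inj; apply: simple_reflK.
  by move=> j; apply/imfsetP/mapP => -[l /= lm ->]; exists l.
by rewrite -map_comp (eq_map (g := fun i => m i)) // => j /=; rewrite mswapE simple_reflK.
Qed.

Lemma size_parts m : size (parts m) = #|` finsupp m|.
Proof. by rewrite size_map. Qed.

Lemma mdeg_mswap i m : mdeg (mswap i m) = mdeg m.
Proof. by apply: mdeg_mact; apply: simple_reflK. Qed.

Lemma sym_below_mul k f g : sym_below k f -> sym_below k g -> sym_below k (series_mul f g).
Proof.
move=> fs gs m i ik; rewrite /series_mul.
rewrite (@reindex_fsbig _ _ _ _ _ (fun p => (mswap i p.1, mswap i p.2))
  [set p | mmul p.1 p.2 = m]).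
  by apply: eq_fsbigr => p _ /=; rewrite fs ?gs.
have sM p q : mswap i (mmul p q) = mmul (mswap i p) (mswap i q).
  by apply: mactM; apply: simple_reflK.
split.
- by move=> [p q] /= <-; rewrite sM.
- by move=> [p q] [p' q'] _ _ /= [/(inv_inj (mswapK i)) -> /(inv_inj (mswapK i)) ->].
- move=> [p q] /= E; exists (mswap i p, mswap i q); rewrite /= ?mswapK //.
  by rewrite -sM E mswapK.
Qed.

Lemma series_mul_neq0 f g m : series_mul f g m != 0 ->
  exists p q, [/\ mmul p q = m, f p != 0 & g q != 0].
Proof.
move=> /eqP nz; apply: contrapT => h; apply: nz; rewrite /series_mul fsbig1 // => -[p q] /= E.
have [->|fp] := eqVneq (f p) 0; first by rewrite mul0r.
have [->|gq] := eqVneq (g q) 0; first by rewrite mulr0.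
by case: h; exists p, q.
Qed.

Lemma sym_below_elem n k : sym_below k (back_elem n k).
Proof.
move=> m i ik; rewrite !back_elemE mdeg_mswap; congr (_ && _)%:R.
have sk j : (simple_refl i j <= k) = (j <= k) by simple_refl_lia.
apply/sqfree_leP/sqfree_leP => h j.
  by have := h (simple_refl i j); rewrite mswapE simple_reflK sk.
by rewrite mswapE; have := h (simple_refl i j); rewrite sk.
Qed.

Lemma bounded_by_elem n k : bounded_by k (back_elem n k).
Proof.
move=> m i ki mi; rewrite back_elemE (_ : sqfree_le k m = false) ?andbF //.
by apply/negP => /sqfree_leP/(_ i); rewrite (_ : (i <= k) = false); lia.
Qed.

Lemma homog_elem n k : homog n (back_elem n k).
Proof.
by move=> m; rewrite back_elemE; case: (mdeg m =P n) => //=; rewrite eqxx.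
Qed.

Lemma homog_mul d e f g : homog d f -> homog e g -> homog (d + e) (series_mul f g).
Proof. by move=> fd ge m /series_mul_neq0[p [q [<- /fd <- /ge <-]]]; rewrite mdegM. Qed.

Lemma bounded_by_mul k f g : bounded_by k f -> bounded_by k g -> bounded_by k (series_mul f g).
Proof.
move=> fk gk m i ki mi; apply/eqP/negPn/negP => /series_mul_neq0[p [q [E fp gq]]].
move: mi; rewrite -E cmM addn_gt0 => /orP[/(fk _ _ ki)|/(gk _ _ ki)] E0.
  by rewrite E0 eqxx in fp.
by rewrite E0 eqxx in gq.
Qed.

Lemma all_le_finsuppP k m : reflect (forall i, k < i -> m i = 0%N)
  (all (fun i => i <= k) (finsupp m)).
Proof.
apply: (iffP allP) => h i.
  move=> ki; apply/eqP; rewrite cmE_eq0; apply/negP => /h; lia.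
by rewrite -cmE_neq0 leNgt => /eqP mi; apply/negP => /h.
Qed.

Lemma mdeg_parts m : mdeg m = sumn (parts m).
Proof. by rewrite sumnE big_map. Qed.

Lemma mdeg_mono_of_seq k t : mdeg (mono_of_seq k t) = sumn t.
Proof.
by elim: t k => [|x t IH] k /=; rewrite ?mdeg1 // (mdegM (monX k x)) mdeg_monX IH.
Qed.

Lemma card_finsupp_le_mdeg m : (#|` finsupp m| <= mdeg m)%N.
Proof.
rewrite -sum1_size /mdeg big_seq [X in (_ <= X)%N]big_seq; apply: leq_sum => i.
by rewrite -cmE_neq0 lt0n.
Qed.

(** The partition of m times n distinct variables that include all those of m. *)
Definition succ_parts (n : nat) (m : mono) : seq nat :=
  [seq x.+1 | x <- parts m] ++ nseq (n - size (parts m)) 1%N.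

(* The symmetric series G such that e_n * G agrees with F on monomials in
   exactly n variables. *)
Definition elem_quotient (n : nat) (k : int) (F : series) : series := fun m =>
  if all (fun i => i <= k) (finsupp m) && (size (parts m) <= n)%N
  then F (mono_of_seq k (succ_parts n m)) else 0.

Lemma homog_elem_quotient d n k F : homog d F -> homog (d - n) (elem_quotient n k F).
Proof.
move=> Fd m; rewrite /elem_quotient; case: ifP => [/andP[_ sn] /Fd|]; last by rewrite eqxx.
rewrite mdeg_mono_of_seq /succ_parts sumn_cat sumn_nseq mul1n mdeg_parts => <-.
have -> : sumn [seq x.+1 | x <- parts m] = (sumn (parts m) + size (parts m))%N.
  by elim: (parts m) => //= x s ->; lia.
lia.
Qed.

Lemma bounded_by_elem_quotient n k F : bounded_by k (elem_quotient n k F).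
Proof.
move=> m i ki mi; rewrite /elem_quotient.
by case: all_le_finsuppP => //= h; move: mi; rewrite h.
Qed.

Lemma sym_below_elem_quotient n k F : sym_below k F -> sym_below k (elem_quotient n k F).
Proof.
move=> Fs m i ik; rewrite /elem_quotient (perm_size (parts_mswap i m)).
have -> : all (fun i => i <= k) (finsupp (mswap i m)) = all (fun i => i <= k) (finsupp m).
  apply/all_le_finsuppP/all_le_finsuppP => h j kj.
    by have := h (simple_refl i j); rewrite mswapE simple_reflK; apply; simple_refl_lia.
  by rewrite mswapE; apply: h; move: kj; simple_refl_lia.
case: ifP => // _; apply: sym_below_perm => //; rewrite /succ_parts (perm_size (parts_mswap i m)).
by rewrite perm_cat2r; apply/perm_map/parts_mswap.
Qed.

Definition support_mono (m : mono) : mono := [cmonom 1 | i in finsupp m]%M.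

Lemma support_monoE m i : support_mono m i = (0 < m i)%N.
Proof. by rewrite cmE fsfun_fun lt0n cmE_neq0; case: ifP. Qed.

Lemma mul_support_mono m : mmul (support_mono m) (divcm m (support_mono m)) = m.
Proof.
by apply: monoP => i; rewrite cmM divcmE support_monoE; case: (m i) => //= p; rewrite subn1 add1n.
Qed.

Lemma finsupp_support_mono m : finsupp (support_mono m) = finsupp m.
Proof. by apply/fsetP => i; rewrite -!cmE_neq0 support_monoE; case: (m i). Qed.

Lemma sqfree_support_mono k m : (forall i, k < i -> m i = 0%N) -> sqfree_le k (support_mono m).
Proof.
move=> mk; apply/sqfree_leP => i; rewrite support_monoE.
by have [//|ki] := boolP (i <= k); [case: (m i)|rewrite mk //; lia].
Qed.

(** Division by the product of the variables of m lowers each part by one and erases the parts equal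
    to one, which the padding by ones restores. *)
Lemma perm_succ_parts m :
  perm_eq (parts m) (succ_parts #|` finsupp m| (divcm m (support_mono m))).
Proof.
set q := divcm _ _; have qE i : q i = (m i).-1.
  by rewrite /q divcmE support_monoE; case: (m i) => [|p] //=; rewrite subn1.
pose l := [seq x.-1 | x <- parts m].
have pq : perm_eq (parts q) [seq x <- l | (0 < x)%N].
  have -> : l = [seq q i | i <- finsupp m].
    by rewrite /l /parts -map_comp; apply: eq_map => i; rewrite /= qE.
  apply: perm_parts_window => [|i]; first exact: fset_uniq.
  by rewrite -!cmE_neq0 qE; case: (m i).
have lm : [seq x.+1 | x <- l] = parts m.
  rewrite /l -map_comp -[RHS]map_id; apply/eq_in_map => x /mapP[i].
  by rewrite -cmE_neq0 => mi -> /=; rewrite prednK // lt0n.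
have sl : size l = #|` finsupp m| by rewrite size_map size_parts.
rewrite -{1}lm; apply: perm_trans (perm_map _ (perm_filter_nonzero l)) _.
rewrite map_cat map_nseq /succ_parts -sl (perm_size pq) size_filter.
rewrite (_ : (size l - _)%N = count (fun x => x == 0%N) l).
  by rewrite perm_cat2r perm_sym; apply: perm_map.
rewrite -(count_predC (fun x => 0 < x)%N l) addKn.
by apply: eq_count => -[|x].
Qed.

(** The only squarefree divisor of m of degree n is the product of its n variables, so the
    convolution has a single term. *)
Lemma elem_mul_quotient k F m : sym_below k F -> (forall i, k < i -> m i = 0%N) ->
  series_mul (back_elem #|` finsupp m| k) (elem_quotient #|` finsupp m| k F) m = F m.
Proof.
move=> Fs mk; set n := #|` finsupp m|; pose p := support_mono m; pose q := divcm m p.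
have sp : sqfree_le k p by apply: sqfree_support_mono.
have dp : mdeg p = n by rewrite (mdeg_sqfree sp) finsupp_support_mono.
have qk i : k < i -> q i = 0%N by move=> ki; rewrite /q divcmE mk.
have qm : (finsupp q `<=` finsupp m)%fset.
  by apply/fsubsetP => i; rewrite -!cmE_neq0 divcmE; case: (m i).
rewrite /series_mul (@fsbigE _ _ _ _ _ [:: (p, q)]) //=.
- rewrite big_cons big_nil ifT ?inE /=; last exact: mul_support_mono.
  rewrite back_elemE dp eqxx sp mul1r addr0 /elem_quotient.
  have -> : all (fun i => i <= k) (finsupp q) by apply/all_le_finsuppP.
  rewrite size_parts fsubset_leq_card //=; apply/esym/sym_below_parts => //.
  rewrite (_ : [seq x <- _ | _] = succ_parts n q); first exact: perm_succ_parts.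
  apply/all_filterP; rewrite /succ_parts all_cat all_nseq orbT andbT.
  by apply/allP => x /mapP[y _ ->].
- by move=> x; rewrite /= inE => /eqP ->; apply: mul_support_mono.
- move=> [p' q'] /= E; rewrite inE back_elemE => n'.
  case: eqP => [dp'|_] /=; last by rewrite mul0r.
  have [sp'|_] := boolP (sqfree_le k p'); last by rewrite mul0r.
  case/negP: n'; have p'm : finsupp p' = finsupp m.
    apply/eqP; rewrite eqEfcard -/n -dp' (mdeg_sqfree sp') leqnn andbT.
    by apply/fsubsetP => i; rewrite -!cmE_neq0 -E cmM; case: (p' i).
  have p'E : p' = p.
    apply: monoP => i; rewrite /p support_monoE lt0n cmE_neq0 -p'm -cmE_neq0.
    by have := elimT (sqfree_leP _ _) sp' i; case: (i <= k); case: (p' i) => [|[|]].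
  rewrite p'E; suff -> : q' = q by [].
  by apply: (@mmul_cancel p); rewrite -{1}p'E E mul_support_mono.
Qed.

(** Induction on the degree and, inside it, on a lower bound n for the number of variables in a
    monomial of F. Subtracting e_n G, with G of smaller degree d - n, clears the monomials in
    exactly n variables; beyond n = d nothing is left. *)
Lemma in_span_sym d F k : homog d F -> bounded_by k F -> sym_below k F -> in_span F.
Proof.
elim/ltn_ind: d F k => d IHd F k Fd Fb Fs.
have [d0|d0] := posnP d.
  apply: spanned_ext (spannedZ (F mone) in_span_one) => m; rewrite /series_one.
  have [->|m1] := eqVneq m mone; first by rewrite mulr1.
  rewrite mulr0; apply/esym/eqP/negPn/negP => /Fd/eqP.
  by rewrite d0 mdeg_eq0 (negbTE m1).
(* As n grows, the induction runs on c, which bounds the distance from n to d + 1. *)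
suff H c n : (d < n + c)%N -> (0 < n)%N -> forall F, homog d F -> bounded_by k F ->
    sym_below k F -> (forall m, (#|` finsupp m| < n)%N -> F m = 0) -> in_span F.
  apply: (H d 1%N) => // m; rewrite ltnS leqn0 cardfs_eq0 => /eqP m0.
  apply/eqP/negPn/negP => /Fd; rewrite /mdeg m0 big_seq_fset0 => E.
  by rewrite -E in d0.
elim: c n {F Fd Fb Fs} => [|c IHc] n dn n0 F Fd Fb Fs Fn.
  apply: spanned_ext (spanned0 _) => m; apply/esym/eqP/negPn/negP => Fm.
  have := card_finsupp_le_mdeg m; rewrite (Fd _ Fm) => h.
  by rewrite Fn ?eqxx // in Fm; rewrite addn0 in dn; apply: leq_ltn_trans h dn.
have [nd|nd] := ltnP d n.
  by apply: (IHc n) => //; lia.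
pose G := elem_quotient n k F.
have Gd : homog (d - n) G by apply: homog_elem_quotient.
have Gb : bounded_by k G by apply: bounded_by_elem_quotient.
have Gs : sym_below k G by apply: sym_below_elem_quotient.
have Gin : in_span G by apply: (IHd (d - n)%N _ _ k) => //; lia.
have eG := in_span_elem_mul k n Gin.
pose H m := F m - series_mul (back_elem n k) G m.
have eGd : homog d (series_mul (back_elem n k) G).
  by rewrite -(subnKC nd); apply: homog_mul => //; apply: homog_elem.
have eGb := bounded_by_mul (@bounded_by_elem n k) Gb.
have Hd : homog d H.
  move=> m; rewrite /H; have [->|/Fd //] := eqVneq (F m) 0.
  by rewrite sub0r oppr_eq0; apply: eGd.
have Hb : bounded_by k H by move=> m i ki mi; rewrite /H (Fb _ i) // (eGb _ i) // subr0.
have Hs : sym_below k H.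
  by move=> m i ik; rewrite /H Fs // (sym_below_mul (@sym_below_elem n k) Gs).
have Hin : in_span H.
  apply: (IHc n.+1) => //; first by lia.
  move=> m; rewrite ltnS leq_eqVlt => /orP[/eqP mn|mn].
    have [/all_le_finsuppP mk|/allPn[i im ik]] := boolP (all (fun i => i <= k) (finsupp m)).
      by rewrite /H /G -mn elem_mul_quotient // subrr.
    by apply: (Hb _ i); [lia|rewrite lt0n cmE_neq0].
  (* A monomial in fewer than n variables has no squarefree divisor of degree n, so e_n G vanishes
     there, as F does. *)
  rewrite /H Fn // sub0r; apply/eqP; rewrite oppr_eq0; apply/negPn/negP.
  move=> /series_mul_neq0[p [q [E pn _]]]; move: pn; rewrite back_elemE.
  case: (mdeg p =P n) => [dp|_]; last by rewrite eqxx.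
  have [sp _|_] := boolP (sqfree_le k p); last by rewrite eqxx.
  move: mn; rewrite -dp (mdeg_sqfree sp) ltnNge => /negP; apply.
  by apply: fsubset_leq_card; rewrite -E mdomD fsubsetUl.
by apply: spanned_ext (spannedD Hin eG) => m; rewrite /H subrK.
Qed.

(** The coefficient of x_N^r in F, as a series without x_N. *)
Definition coef_at (N : int) (r : nat) (F : series) : series := fun m =>
  if m N == 0%N then F (mmul (monX N r) m) else 0.

Lemma iter_mulx_coef_at N r F m :
  iter r (mulx N) (coef_at N r F) m = if m N == r then F m else 0.
Proof.
suff H s : iter s (mulx N) (coef_at N r F) m =
    if m N == s then F (mmul (monX N r) (divcm m (monX N s))) else 0.
  rewrite H; case: eqP => // mN; congr F; apply: monoP => i.
  rewrite (cmM i (monX N r)) divcmE monXE; have [<-|_] := eqVneq N i; last by rewrite mul0n subn0.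
  by rewrite mN mul1n subnn addn0.
elim: s m => [|s IH] m.
  rewrite /= /coef_at; case: ifP => // _; congr F; congr mmul; apply: monoP => i.
  by rewrite divcmE cm1 subn0.
rewrite iterS /mulx; case: ifP => mN; last by case: eqP => // E; rewrite E in mN.
rewrite IH mdivxE eqxx; case: (m N) mN => // p _; rewrite subn1 eqSS.
case: ifP => // _; congr F; congr mmul; apply: monoP => i.
by rewrite (divcmE (mdivx m N)) mdivxE divcmE !monXE -subnDA -mulnS.
Qed.

(* Splitting off the powers of the finitely many variables x_i, i > k, leaves
   symmetric series in the variables x_i, i <= k. *)
Lemma in_span_bounded d F k (N : nat) :
  homog d F -> bounded_by (k + N%:Z) F -> sym_below k F -> in_span F.
Proof.
elim: N d F => [|N IH] d F Fd Fb Fs.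
  by apply: (in_span_sym Fd _ Fs); rewrite addr0 in Fb.
pose M := k + N.+1%:Z.
have Fr r : in_span (iter r (mulx M) (coef_at M r F)).
  have : in_span (coef_at M r F).
    apply: (IH (d - r)%N).
    - move=> m; rewrite /coef_at; case: ifP => _; last by rewrite eqxx.
      by move=> /Fd; rewrite (mdegM (monX M r)) mdeg_monX => <-; rewrite addKn.
    - move=> m i ki mi; rewrite /coef_at; case: eqP => // mM.
      have iM : M < i.
        have : i != M by apply/eqP => iM; rewrite iM mM in mi.
        by rewrite /M; lia.
      by apply: (Fb _ i) => //; rewrite (cmM i (monX M r)) addn_gt0 mi orbT.
    - move=> m i ik; rewrite /coef_at mswapE (_ : simple_refl i M = M); last first.
        by rewrite /M; simple_refl_lia.
      case: ifP => // _; rewrite -[RHS](Fs _ i ik); congr F.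
      rewrite [RHS]mactM; last exact: simple_reflK.
      congr mmul; apply: monoP => j; rewrite -/(mswap i _) mswapE !monXE.
      by congr (_ * _)%N; congr nat_of_bool; rewrite /M; simple_refl_lia.
  by move: (coef_at M r F) => C; elim: r => //= r IHr /IHr; apply: in_span_mulx.
(* F has degree d, so only the powers 0, ..., d of x_M occur. *)
apply: spanned_ext (spanned_sum (iota 0 d.+1) (fun=> 1) Fr) => m.
under eq_bigr do rewrite mul1r iter_mulx_coef_at.
have [md|md] := ltnP (m M) d.+1.
  rewrite (bigD1_seq (m M)) ?iota_uniq ?mem_iota //= eqxx big1 ?addr0 // => r.
  by rewrite eq_sym => /negbTE ->.
rewrite big1_seq => [|r /andP[_]]; last first.
  by rewrite mem_iota; case: eqP => // E; lia.
apply/esym/eqP/negPn/negP => /Fd mdegm.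
have mM : M \in finsupp m by rewrite -cmE_neq0 -lt0n; apply: leq_ltn_trans md.
by move: md; rewrite -mdegm /mdeg (big_fsetD1 _ mM) /= ltnNge leq_addr.
Qed.

(** All descents of w are positive, so F_w is symmetric in the x_i with i <= 0. *)
Lemma stable_schubert_in_span w : S_infty w -> in_span (stable_schubert w).
Proof.
move=> wS; have [n wn] := S_infty_fin wS.
apply: (@in_span_bounded (inv_number w) _ 0 n).
- by move=> m; apply: stable_schubert_deg.
- by move=> m i ni; apply: stable_schubert_bound wn _; lia.
move=> m i i0; have := stable_schubert_is_divdiff i wS m.
rewrite /at_descent ifN; last by apply/negP => /(S_infty_descent wS); lia.
by rewrite !mulx0 subrr => /eqP; rewrite subr_eq0 => /eqP.
Qed.

(** The coefficients attached to repeated indices of the list are added up. *)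
Lemma in_span_fsfun (F : series) : in_span F -> exists k : {fsfun mono -> rat with 0},
  forall mu, F mu = \sum_(a <- finsupp k) k a * back_e a mu.
Proof.
move=> [s [_ sE]]; pose D := [fset p.2 | p in s]%fset.
pose k : {fsfun mono -> rat with 0} := [fsfun a in D => \sum_(p <- s | p.2 == a) p.1].
have kE a : k a = \sum_(p <- s | p.2 == a) p.1.
  rewrite fsfun_fun; case: ifP => // /negP aD; rewrite big1_seq // => p /andP[/eqP pa ps].
  by case: aD; apply/imfsetP; exists p.
exists k => mu; rewrite sE.
have kD : (finsupp k `<=` D)%fset.
  by apply/fsubsetP => a; rewrite mem_finsupp fsfun_fun; case: ifP => //; rewrite eqxx.
rewrite (big_fset_incl _ kD) => [|a _]; last by rewrite mem_finsupp negbK => /eqP ->; rewrite mul0r.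
under [RHS]eq_bigr do rewrite kE big_distrl /= big_mkcond /=.
rewrite exchange_big /= big_seq [RHS]big_seq; apply: eq_bigr => p ps.
have pD : p.2 \in D by apply/imfsetP; exists p.
rewrite (big_fsetD1 _ pD) eqxx big1_fset => [|a]; first by rewrite [RHS]addr0.
by rewrite in_fsetD1 eq_sym => /andP[/negbTE ->].
Qed.

Theorem lemma6p5 (w : int -> int) (hw : S_infty w) :
  \sum_(a <- finsupp (kappa w)) kappa w a * multinomial a
    = (#|` fset_set (reduced_words w)|)%:R.
Proof.
apply: (sum_multinomial hw) => mu; rewrite -(back_schubertE hw).
have /in_span_fsfun[k kE] := stable_schubert_in_span hw.
rewrite -(back_schubertE hw) in kE.
pose P : set {fsfun mono -> rat with 0} := [set k : {fsfun mono -> rat with 0} | forall mu : mono,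
    back_schubert w mu = \sum_(a <- finsupp k) k a * back_e a mu].
have : exists k : {fsfun mono -> rat with 0}, P k by exists k.
(* An expansion exists, so the value picked for [kappa] is one. *)
by move=> /(xgetPex [fsfun]); apply.
Qed.
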